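(* There exists a constant $C>0$, depending only on the initial mesh $\mathcal M_0$, its direction labeling $\mathrm{di}$ and $p$, such that the following holds. Let $J\in\mathbb N$ and let $\mathcal M_0,\mathcal M_1,\dots,\mathcal M_J$ with $\mathcal M_j=(\mathcal Q_j,\mathcal E_j,\mathcal N_j)$ be any sequence of T-meshes with $$\mathcal M_j=\mathrm{REFINE}(\mathcal M_{j-1},E_{j-1}),\qquad E_{j-1}\in\mathcal E_{j-1},\qquad j\in\{1,\dots,J\},$$ and let $\mathcal E_{\mathrm M}=\{E_0,\dots,E_{J-1}\}$ be the set of marked edges. Then $$\#\mathcal E_J-\#\mathcal E_0\le C\;\#\mathcal E_{\mathrm M}.$$
   Context: Throughout, $p\ge1$ is an odd integer (the polynomial degree). Meshes. $\Omega\subset\mathbb R^2$ is an open bounded domain with polygonal boundary. (More generally, $\Omega$ may be a two-dimensional domain or orientable surface in $\mathbb R^d$ partitioned into curved quadrilaterals with the same combinatorics.) A mesh $\mathcal M=(\mathcal Q,\mathcal E,\mathcal N)$ partitions $\Omega$ and its boundary into finitely many pairwise disjoint open quadrilateral elements, open edges (without end points) and nodes. For an element $Q$, $\mathcal E(Q)$ and $\mathcal N(Q)$ denote the edges and nodes contained in $\partial Q$. The mesh is regular if every element has exactly four edges and four nodes and the closures of any two distinct elements are disjoint, share exactly one edge and its two nodes, or share exactly one node. The initial mesh $\mathcal M_0$ is regular. Each element $Q$ of $\mathcal M_0$ is the image of the parameter domain $(0,1)^2$ under a regular, positively oriented $C^\infty$-map, and the maps of two elements sharing an edge fit together continuously along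 it (up to Euclidean motions of the parameter domains). All edges of $\mathcal M_0$ have length $1$. Bisections and midpoints of edges and elements are understood in parameter coordinates. T-meshes are obtained from $\mathcal M_0$ by successive edge bisections and element bisections as in SUBDIV below. SUBDIV$(\mathcal M,E)$: bisect $E$ at its midpoint $\mathrm{mid}(E)$, i.e. remove $E$, add its two children $E_1,E_2$ and the node $\mathrm{mid}(E)$. For each of the (at most two) elements $Q$ neighboring $E$: if the edge opposite to $E$ in $Q$ has already been subdivided, add a new edge $\tilde E$ connecting the midpoints of $E$ and of this opposite edge, and replace $Q$ by the two elements into which $\tilde E$ divides it. Refinement level $\ell$: $\ell(E)=0$ for all edges of $\mathcal M_0$; children satisfy $\ell(E_1)=\ell(E_2)=\ell(E)+1$; a new edge $\tilde E$ has the same level as its opposite edges. Direction index $\mathrm{di}$: it is assumed that there is a map $\mathrm{di}$ from the edges of $\mathcal M_0$ to $\mathbb N$ (a direction labeling) such that in every element opposite edges have equal values and neighboring (adjacent) edges have distinct values. Children inherit the direction index of their parent, and a new edge $\tilde E$ has the direction index of its opposite edges. Mesh metric: let $\mathcal M_{[0]}=\mathcal M_0$ and let $\mathcal M_{[j+1]}$ be the uniform dyadic refinement of $\mathcal M_{[j]}$ (every element split into four). For nodes $A\ne B$ of $\mathcal M_{[j]}$, let $\mathrm{dist}_{[j]}(A,B)$ be the minimal $n$ such that there is a sequence of $n$ elements of $\mathcal M_{[j]}$, consecutive ones sharing a vertex, with $A$ a vertex of the first and $B$ a vertex of the last; $\mathrm{dist}_{[j]}(A,A)=0$. Then $\mathrm{dist}(A,B)=2^{-j}\mathrm{dist}_{[j]}(A,B)$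 defines a metric on the union of all nodes of all $\mathcal M_{[j]}$, extended continuously to $\Omega$. For edges, $\mathrm{dist}(E,E')=\mathrm{dist}(\mathrm{mid}(E),\mathrm{mid}(E'))$. Edge neighborhood: $\mathrm{neighb}(\mathcal M,E)=\{E'\in\mathcal E\mid \mathrm{dist}(E,E')\le\frac{p+1}{2}\,2^{-\ell(E)}\}$. REFINE$(\mathcal M,E)$: while there is $E'\in\mathrm{neighb}(\mathcal M,E)$ with $\ell(E')<\ell(E)$, or with $\ell(E')=\ell(E)$ and $\mathrm{di}(E')<\mathrm{di}(E)$, do: for all $E'\in\mathrm{neighb}(\mathcal M,E)$ satisfying one of these two conditions, set $\mathcal M\leftarrow\mathrm{REFINE}(\mathcal M,E')$. After the loop, set $\mathcal M\leftarrow\mathrm{SUBDIV}(\mathcal M,E)$ and return $\mathcal M$. *)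

(* Defs.v *)
From HB Require Import structures.
From mathcomp Require Import all_boot all_order all_algebra.
From mathcomp Require Import finmap.
From mathcomp Require Import all_classical all_reals all_analysis.
Set Implicit Arguments.
Unset Strict Implicit.
Unset Printing Implicit Defensive.
Import Order.TTheory GRing.Theory Num.Theory.
Import numFieldNormedType.Exports.
Local Open Scope fset_scope.
Local Open Scope classical_set_scope.
Local Open Scope ring_scope.

Section ParameterSquare.
Variable R : realType.

Definition unit_square : set (R * R) :=
  [set u | 0 < u.1 < 1 /\ 0 < u.2 < 1].

Definition closed_square : set (R * R) :=
  [set u | 0 <= u.1 <= 1 /\ 0 <= u.2 <= 1].

(* The corners in counterclockwise order. The indices of corners and sides
   live in 'I_4 = Z/4; side i joins corner i to corner i + 1, so that
   i + 2 is the side opposite to side i. *)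
Definition corner (i : 'I_4) : R * R :=
  nth (0, 0) [:: (0, 0); (1, 0); (1, 1); (0, 1)] i.

Definition segpt (u v : R * R) (t : R) : R * R :=
  ((1 - t) * u.1 + t * v.1, (1 - t) * u.2 + t * v.2).

Definition midpt (u v : R * R) : R * R :=
  ((u.1 + v.1) / 2, (u.2 + v.2) / 2).

Definition axis (i : 'I_2) : R * R := if i == ord0 then (1, 0) else (0, 1).

(* All iterated partial derivatives of f of order at most n exist and are
   continuous on the open unit square. *)
Fixpoint class_C (n : nat) (f : R * R -> R) : Prop :=
  (forall u, unit_square u -> {for u, continuous f}) /\
  match n with
  | 0 => True
  | n'.+1 => forall i : 'I_2,
      (forall u, unit_square u -> derivable f u (axis i)) /\
      class_C n' (fun u => 'D_(axis i) f u)
  end.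

Definition jacobian_matrix (d : nat) (F : R * R -> 'rV[R]_d) (u : R * R)
    : 'M[R]_(2, d) :=
  \matrix_(i < 2, j < d) 'D_(axis i) (fun w => F w ord0 j) u.

End ParameterSquare.

Arguments unit_square R : clear implicits.
Arguments closed_square R : clear implicits.
Arguments corner R : clear implicits.

(* A regular mesh of a domain or oriented surface Omega in R^d, given by
   parametrizations of its elements. A chart is smooth on the open square and
   extends injectively and continuously to the closed square, whose sides and
   corners give the four edges and four nodes of the element.
   Two closed elements meet in nothing, in one node, or in one whole edge.
   Along a shared edge, the charts agree up to the motion of the parameter
   domain which identifies the two sides; since the charts are positively
   oriented, the two counterclockwise boundaries run through that edge in
   opposite directions (whence an edge has at most two neighboring elements).
   A planar domain with polygonal boundary is a special case with d = 2. *)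
Record quad_mesh (R : realType) (d : nat) := QuadMesh {
  Omega : set 'rV[R]_d;
  elt : finType;
  chart : elt -> R * R -> 'rV[R]_d;
  Omega_connected : connected Omega;
  mesh_cover :
    closure Omega = \bigcup_(q in [set: elt]) (chart q @` closed_square R);
  chart_continuous : forall q, {within closed_square R, continuous (chart q)};
  chart_injective : forall q, set_inj (closed_square R) (chart q);
  chart_smooth :
    forall q (j : 'I_d) n, class_C n (fun u => chart q u ord0 j);
  chart_regular :
    forall q u, unit_square R u -> \rank (jacobian_matrix (chart q) u) = 2%N;
  mesh_regular : forall q q', q != q' ->
    let inter := chart q @` closed_square R `&` chart q' @` closed_square R in
    [\/ inter = set0,
        exists a b : 'I_4, inter = [set chart q (corner R a)] /\
          chart q (corner R a) = chart q' (corner R b)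
      | exists a b : 'I_4,
          inter = chart q @` (segpt (corner R a) (corner R (a + 1))
                                @` [set t | 0 <= t <= 1]) /\
          (forall t : R, 0 <= t <= 1 ->
             chart q (segpt (corner R a) (corner R (a + 1)) t) =
             chart q' (segpt (corner R b) (corner R (b + 1)) (1 - t)))]
}.

(* An open edge (a set of points) with its refinement level and its direction
   index; both are fixed when the edge is created. *)
Record edge (R : realType) (d : nat) := Edge {
  pts : set 'rV[R]_d;
  level : nat;
  dir : nat
}.

HB.instance Definition _ (R : realType) (d : nat) := gen_eqMixin (edge R d).
HB.instance Definition _ (R : realType) (d : nat) := gen_choiceMixin (edge R d).

Section TMeshes.
Variables (R : realType) (d : nat) (M0 : quad_mesh R d).

Definition arc (q : elt M0) (u v : R * R) : set 'rV[R]_d :=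
  chart q @` (segpt u v @` [set t | 0 < t < 1]).

(* By mesh_regular, the midpoint does not depend on the chart in which the
   edge A is parametrized. *)
Definition mid (A : set 'rV[R]_d) : 'rV[R]_d :=
  xget 0 [set X | exists q u v, [/\ closed_square R u, closed_square R v,
    A = arc q u v & X = chart q (midpt u v)]].

(* A rectangle in parameter coordinates, represented by its chart and its four
   corners in counterclockwise order. *)
Definition cell : Type := (elt M0 * {ffun 'I_4 -> R * R})%type.
HB.instance Definition _ := Choice.on cell.

Definition vertex (c : cell) (i : 'I_4) : 'rV[R]_d := chart c.1 (c.2 i).

Definition side (c : cell) (i : 'I_4) : set 'rV[R]_d :=
  arc c.1 (c.2 i) (c.2 (i + 1)).

Definition cell0 (q : elt M0) : cell := (q, [ffun i => corner R i]).

(* The cut joins the midpoints of sides i and i + 2; it is parallel to sides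
   i + 1 and i + 3. *)
Definition cut (c : cell) (i : 'I_4) : set 'rV[R]_d :=
  arc c.1 (midpt (c.2 i) (c.2 (i + 1))) (midpt (c.2 (i + 2)) (c.2 (i + 3))).

Definition half1 (c : cell) (i : 'I_4) : cell :=
  (c.1, [ffun k => if k == i + 1 then midpt (c.2 i) (c.2 (i + 1))
                   else if k == i + 2 then midpt (c.2 (i + 2)) (c.2 (i + 3))
                   else c.2 k]).

Definition half2 (c : cell) (i : 'I_4) : cell :=
  (c.1, [ffun k => if k == i then midpt (c.2 i) (c.2 (i + 1))
                   else if k == i + 3 then midpt (c.2 (i + 2)) (c.2 (i + 3))
                   else c.2 k]).

(* Quarters of a rectangle are its images under the homotheties of ratio 1/2
   centered at its corners. *)
Definition quarter (c : cell) (k : 'I_4) : cell :=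
  (c.1, [ffun i => midpt (c.2 k) (c.2 i)]).

Fixpoint uniform_mesh (j : nat) : {fset cell} :=
  match j with
  | 0 => [fset cell0 q | q : elt M0]
  | j'.+1 => [fset quarter c k | c in uniform_mesh j', k : 'I_4]
  end.

Definition is_vertex (X : 'rV[R]_d) (c : cell) : Prop :=
  exists i, X = vertex c i.

Definition uniform_node (j : nat) (X : 'rV[R]_d) : Prop :=
  exists2 c, c \in uniform_mesh j & is_vertex X c.

Definition linked (j : nat) (A B : 'rV[R]_d) (n : nat) : Prop :=
  (0 < n)%N /\ exists c : nat -> cell,
    [/\ forall i, (i < n)%N -> c i \in uniform_mesh j,
        is_vertex A (c 0%N),
        is_vertex B (c n.-1)
      & forall i, (i.+1 < n)%N ->
          exists X, is_vertex X (c i) /\ is_vertex X (c i.+1)].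

(* The infimum over nat is a minimum; it is +oo only if there is no linking
   sequence. *)
Definition dist_at (j : nat) (A B : 'rV[R]_d) : \bar R :=
  if `[< A = B >] then 0%E else ereal_inf [set n%:R%:E | n in linked j A B].

(* The value 2^-j dist_[j](A, B) is the same for all j such that A and B are
   nodes of the j-th uniform refinement, so the infimum only serves to select
   it. Midpoints of edges of T-meshes are such nodes, so that the continuous
   extension of the metric is not needed. *)
Definition mesh_dist (A B : 'rV[R]_d) : \bar R :=
  ereal_inf [set ((2 ^- j)%:E * dist_at j A B)%E |
              j in [set j | uniform_node j A /\ uniform_node j B]].

Definition edge_dist (E F : edge R d) : \bar R :=
  mesh_dist (mid (pts E)) (mid (pts F)).

Record tmesh := TMesh {
  elements : {fset cell};
  edges : {fset edge R d};
  nodes : {fset 'rV[R]_d}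
}.

Definition direction_labeling (di : set 'rV[R]_d -> nat) : Prop :=
  forall (q : elt M0) (i : 'I_4),
    di (side (cell0 q) i) = di (side (cell0 q) (i + 2)) /\
    di (side (cell0 q) i) <> di (side (cell0 q) (i + 1)).

Definition initial_tmesh (di : set 'rV[R]_d -> nat) : tmesh :=
  TMesh [fset cell0 q | q : elt M0]
        [fset Edge (side (cell0 q) i) 0 (di (side (cell0 q) i))
          | q : elt M0, i : 'I_4]
        [fset vertex (cell0 q) i | q : elt M0, i : 'I_4].

(* Each of the four sides of an element either is an edge of the mesh or has
   been subdivided. If E is only part of a side of an element, then it has no
   opposite edge there, and the element is kept. *)
Definition to_split (M : tmesh) (E : edge R d) (ci : cell * 'I_4) : Prop :=
  side ci.1 ci.2 = pts E /\
  ~ (exists2 F, F \in edges M & pts F = side ci.1 (ci.2 + 2)).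

Definition splits (M : tmesh) (E : edge R d) : {fset cell * 'I_4} :=
  [fset ci in (elements M `*` [fset i | i : 'I_4])%fset
    | `[< to_split M E ci >]].

(* At least one of the two sides of ci.1 parallel to the cut is still an edge
   V of the mesh; the cut inherits its level and direction index. *)
Definition cut_edges (M : tmesh) (E : edge R d) : {fset edge R d} :=
  [fset Edge (cut civ.1.1 civ.1.2) (level civ.2) (dir civ.2)
    | civ in (splits M E `*` edges M)%fset
    & `[< pts civ.2 = side civ.1.1 (civ.1.2 + 1) \/
          pts civ.2 = side civ.1.1 (civ.1.2 + 3) >]].

(* The result does not depend on the chart in which E is parametrized. *)
Definition subdiv (M : tmesh) (E : edge R d) (M' : tmesh) : Prop :=
  exists (q : elt M0) (u v : R * R),
    [/\ closed_square R u, closed_square R v, pts E = arc q u v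
      & let child A := Edge A (level E).+1 (dir E) in
        M' = TMesh
          (elements M `\` [fset ci.1 | ci in splits M E]
             `|` [fset half1 ci.1 ci.2 | ci in splits M E]
             `|` [fset half2 ci.1 ci.2 | ci in splits M E])%fset
          (edges M `\ E
             `|` [fset child (arc q u (midpt u v)); child (arc q (midpt u v) v)]
             `|` cut_edges M E)%fset
          (mid (pts E) |` nodes M)%fset].

Variable p : nat.

Definition neighb (M : tmesh) (E : edge R d) : {fset edge R d} :=
  [fset F in edges M
    | `[< (edge_dist E F <= (p.+1%:R / 2 * 2 ^- level E)%:E)%E >]].

Definition obstructing (M : tmesh) (E : edge R d) : {fset edge R d} :=
  [fset F in neighb M E
    | (level F < level E)%N || (level F == level E) && (dir F < dir E)%N].

(* Big-step semantics of the recursive algorithm: refine M E M' means that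
   REFINE(M, E) may return M'. In each pass of the while loop, the obstructing
   edges are treated in an arbitrary order s; those which have already been
   subdivided in the course of the pass are skipped. *)
Inductive refine : tmesh -> edge R d -> tmesh -> Prop :=
| Refine M E M1 M2 :
    refine_loop M E M1 -> subdiv M1 E M2 -> refine M E M2
with refine_loop : tmesh -> edge R d -> tmesh -> Prop :=
| LoopExit M E :
    obstructing M E = fset0 -> refine_loop M E M
| LoopStep M E s M1 M2 :
    obstructing M E != fset0 -> perm_eq s (obstructing M E) ->
    refine_pass M s M1 -> refine_loop M1 E M2 -> refine_loop M E M2
with refine_pass : tmesh -> seq (edge R d) -> tmesh -> Prop :=
| PassNil M : refine_pass M [::] M
| PassSkip M F s M1 :
    F \notin edges M -> refine_pass M s M1 -> refine_pass M (F :: s) M1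
| PassCall M F s M1 M2 :
    F \in edges M -> refine M F M1 -> refine_pass M1 s M2 ->
    refine_pass M (F :: s) M2.

End TMeshes.

(* Main.v *)
From HB Require Import structures.
Require Import Defs.
From mathcomp Require Import all_boot all_order all_algebra.
From mathcomp Require Import finmap.
From mathcomp Require Import all_classical all_reals all_analysis.
From mathcomp Require Import ring lra zify.

(** The argument is that of Binev, Dahmen and DeVore for adaptive bisection:
    every subdivided edge collects a charge of at least 1 from the marked
    edges, and every marked edge hands out a bounded charge in total. Since a
    subdivision creates boundedly many edges (step_card), the bound follows.

    The refinement of a marked edge E triggers a cascade of requests. Along the
    cascade the pair of level and direction index decreases lexicographically,
    and an edge of level l reaches out to a distance of order 2^-l only; as
    there are finitely many direction indices, a requested edge F lies within a
    multiple of 2^-(level F) of E, and level F <= level E (below_close). By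
    packing, boundedly many edges of each level are that close to E. This is
    not enough, because level E is unbounded, and so the charge that F receives
    from E is damped by the factor 2^-(level E - level F). To see that F still
    collects 1, start at the marked edge whose refinement subdivided F, pass
    to the earlier marked edge whose refinement created that one, and so on:
    levels drop by at most 1 in each step, so the walk meets an edge of the
    level of F, which contributes 1; and as long as the collected charge is below
    1, the walk has covered at most a multiple of 2^-(level F), since the lengths
    of its steps are proportional to the charges (charge_ge).

    Distances are measured by chains of dyadic boxes. A chain can be refined
    without loss (links_refine), and, which is the crucial point, also be
    coarsened at half the number of boxes (links_coarsen); this makes the mesh
    metric comparable between levels, although the charts need not be bi-Lipschitz.

    The remaining work is to show that subdivisions keep the mesh in a standard
    form (valid_step). The key is that an edge E is subdivided only when it has
    no obstructing neighbor: the sides adjacent to E are then not longer than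
    E, and if equally long, have larger direction index. Hence elements stay
    squares or half squares, an edge of level l lies on the grid of level
    l + 1, and the edges, elements and nodes stay disjoint. The last property
    ensures that no edge is subdivided twice and no edge is marked twice: the
    midpoint of a subdivided edge is a node from then on, and edges avoid nodes
    (steps_new, marked_inj). *)

Set Implicit Arguments.
Unset Strict Implicit.
Unset Printing Implicit Defensive.
Import Order.TTheory GRing.Theory Num.Theory.
Local Open Scope fset_scope.
Local Open Scope ring_scope.
Local Notation arc := Defs.arc.
Local Notation cut := Defs.cut.

(** * Segments in the parameter plane *)

Section Segments.
Variable R : realType.
Implicit Types (u v w : R * R) (t x y : R).

(** A boolean selects an axis, false the first one: pt o x y has coordinate x
    along the axis o and y along the other, which lets horizontal and vertical
    segments share their proofs. *)
Definition pt (o : bool) x y : R * R := if o then (y, x) else (x, y).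
Definition co (o : bool) u : R := if o then u.2 else u.1.

Lemma co_pt o x y : co o (pt o x y) = x.
Proof. by case: o. Qed.
Lemma co_ptN o x y : co (~~ o) (pt o x y) = y.
Proof. by case: o. Qed.
Lemma pt_co o u : pt o (co o u) (co (~~ o) u) = u.
Proof. by case: o u => [] []. Qed.

Lemma axis_cases o o' : o' = o \/ o' = ~~ o.
Proof. by case: o o' => [] []; auto. Qed.

Lemma co_inj u v : (forall o, co o u = co o v) -> u = v.
Proof. by move: u v => [a b] [c e] h; have := (h false, h true); case=> /= -> ->. Qed.

Lemma co_segpt o u v t : co o (segpt u v t) = (1 - t) * co o u + t * co o v.
Proof. by case: o. Qed.
Lemma co_midpt o u v : co o (midpt u v) = (co o u + co o v) / 2.
Proof. by case: o. Qed.

Lemma squareP u : closed_square R u <-> forall o, 0 <= co o u <= 1.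
Proof.
split=> [[h1 h2] [] //|h]; split; [exact: (h false)|exact: (h true)].
Qed.

Lemma segptC u v t : segpt u v (1 - t) = segpt v u t.
Proof. by apply: co_inj => o; rewrite !co_segpt; ring. Qed.

Lemma segpt_half u v t : segpt u (midpt u v) t = segpt u v (t / 2).
Proof. by apply: co_inj => o; rewrite !co_segpt co_midpt; field. Qed.

Lemma midpt_seg u v : midpt u v = segpt u v (1 / 2).
Proof. by apply: co_inj => o; rewrite co_segpt co_midpt; field. Qed.

Lemma midptC u v : midpt u v = midpt v u.
Proof. by apply: co_inj => o; rewrite !co_midpt addrC. Qed.

Lemma segpt_convex x0 x1 t a b : 0 <= t <= 1 -> a <= x0 <= b -> a <= x1 <= b ->
  a <= (1 - t) * x0 + t * x1 <= b.
Proof.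
move=> /andP[t0 t1] /andP[h1 h2] /andP[h3 h4].
by apply/andP; split; nra.
Qed.

Lemma square_seg u v t : 0 <= t <= 1 -> closed_square R u ->
  closed_square R v -> closed_square R (segpt u v t).
Proof.
move=> ht /squareP hu /squareP hv; apply/squareP => o.
by rewrite co_segpt; apply: segpt_convex.
Qed.

Lemma open_closed01 t : 0 < t < 1 -> 0 <= t <= 1.
Proof. by case/andP=> /ltW -> /ltW ->. Qed.

Lemma open_seg_ge a x y :
  (forall t, 0 < t < 1 -> a <= (1 - t) * x + t * y) -> a <= x.
Proof.
move=> h; rewrite leNgt; apply/negP => xa.
have h2 := h (1 / 2) ltac:(lra).
have d0 : 0 < y - x by lra.
have hq : 2 * (a - x) <= y - x by lra.
pose t := (a - x) / (2 * (y - x)).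
have tE : t * (y - x) = (a - x) / 2 by rewrite /t; field; lra.
have := h t; have -> : 0 < t < 1 by apply/andP; split; nra.
move=> /(_ isT); nra.
Qed.

Lemma open_seg_bounds a b x y :
  (forall t, 0 < t < 1 -> a <= (1 - t) * x + t * y <= b) ->
  (a <= x <= b) /\ (a <= y <= b).
Proof.
have gen (x' y' : R) : (forall t, 0 < t < 1 -> a <= (1 - t) * x' + t * y' <= b) ->
    a <= x' <= b.
  move=> h; apply/andP; split.
    by apply: (@open_seg_ge _ _ y') => t /h /andP[].
  rewrite -lerN2; apply: (@open_seg_ge _ _ (- y')) => t /h /andP[_ h2].
  by lra.
move=> h; split; first exact: (gen x y).
apply: (gen y x) => t ht; have := h (1 - t) ltac:(lra).
by rewrite opprB addrCA subrr addr0 addrC.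
Qed.

(** The l1 length of the segment; on axis-parallel segments it is the length. *)
Definition lenv u v : R := `|u.1 - v.1| + `|u.2 - v.2|.

Lemma lenvC u v : lenv u v = lenv v u.
Proof. by rewrite /lenv (distrC u.1) (distrC u.2). Qed.

Lemma segpt_inj u v s t : u <> v -> segpt u v s = segpt u v t -> s = t.
Proof.
move=> uv E; apply: contrapT => st; apply: uv; apply: co_inj => o.
have := congr1 (co o) E; rewrite !co_segpt => E'.
have : (s - t) * (co o v - co o u) = 0 by lra.
by move/eqP; rewrite mulf_eq0 => /orP[]/eqP; [move/subr0_eq|lra].
Qed.

(** The endpoints are the extrema of the coordinates. Along an axis-parallel
    segment at most one coordinate varies, so they are determined up to their
    order. *)
Lemma open_seg_inj o u v u' v' : co (~~ o) u = co (~~ o) v ->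
  (forall t, 0 < t < 1 -> exists2 s, 0 < s < 1 & segpt u v t = segpt u' v' s) ->
  (forall t, 0 < t < 1 -> exists2 s, 0 < s < 1 & segpt u' v' t = segpt u v s) ->
  (u' = u /\ v' = v) \/ (u' = v /\ v' = u).
Proof.
move=> hN.
have bnd o' (x x' : R) t : 0 <= t <= 1 ->
    Num.min x x' <= (1 - t) * x + t * x' <= Num.max x x'.
  by move=> ht; apply: segpt_convex => //; rewrite ?ge_min ?le_max lexx /= ?orbT.
have sub w z w' z' o' :
    (forall t, 0 < t < 1 -> exists2 s, 0 < s < 1 & segpt w z t = segpt w' z' s) ->
    (Num.min (co o' w') (co o' z') <= co o' w <= Num.max (co o' w') (co o' z')) /\
    (Num.min (co o' w') (co o' z') <= co o' z <= Num.max (co o' w') (co o' z')).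
  move=> h; apply: open_seg_bounds => t ht; have [s hs E] := h t ht.
  by rewrite -co_segpt E co_segpt; apply: bnd => //; exact: open_closed01.
move=> h1 h2.
have A o' := sub _ _ _ _ o' h1.
have B o' := sub _ _ _ _ o' h2.
have [] := B (~~ o); rewrite hN minxx maxxx => b1 b2.
have e1 : co (~~ o) u' = co (~~ o) v by lra.
have e2 : co (~~ o) v' = co (~~ o) v by lra.
have key : (co o u' = co o u /\ co o v' = co o v) \/
           (co o u' = co o v /\ co o v' = co o u).
  have [] := A o; have [] := B o.
  by case: (leP (co o u') (co o v')); case: (leP (co o u) (co o v)) => *;
    first [left; split; lra|right; split; lra].
by case: key => [[k1 k2]|[k1 k2]]; [left|right]; split; apply: co_inj => o';
  have [->|->] := axis_cases o o'; lra.
Qed.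

End Segments.

(** * Gluing of charts *)

Section Gluing.
Variables (R : realType) (d : nat) (M0 : quad_mesh R d).
Implicit Types (q : elt M0) (u v w : R * R) (t : R) (X : 'rV[R]_d) (a b i : 'I_4).

Lemma ord4_ind (P : 'I_4 -> Prop) :
  P (Ordinal (isT : 0 < 4)%N) -> P (Ordinal (isT : 1 < 4)%N) ->
  P (Ordinal (isT : 2 < 4)%N) -> P (Ordinal (isT : 3 < 4)%N) -> forall i, P i.
Proof.
move=> p0 p1 p2 p3 [[|[|[|[|//]]]] h]; by rewrite (bool_irrelevance h isT).
Qed.

Lemma chart_inj q u v : closed_square R u -> closed_square R v ->
  chart q u = chart q v -> u = v.
Proof. by move=> hu hv; apply: chart_injective; apply/mem_set. Qed.

Lemma arcP q u v X :
  arc q u v X <-> exists2 t, 0 < t < 1 & X = chart q (segpt u v t).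
Proof.
split=> [[_ [t ht <-] <-]|[t ht ->]]; first by exists t.
by exists (segpt u v t) => //; exists t.
Qed.

Lemma arcC q u v : arc q u v = arc q v u.
Proof.
by apply/seteqP; split=> X /arcP[t ht ->]; apply/arcP; exists (1 - t);
  rewrite ?segptC //; lra.
Qed.

Definition sidept a t : R * R := segpt (corner R a) (corner R (a + 1)) t.

(** The sides alternate between the axes, so that odd a is the axis of side a;
    sides 2 and 3 run backwards. *)
Lemma sideptE a t :
  sidept a t = pt (odd a) (if (a < 2)%N then t else 1 - t) ((0 < a < 3)%N%:R).
Proof.
by elim/ord4_ind: a; apply: co_inj => o; rewrite /sidept co_segpt;
  case: o; rewrite /corner /pt /co /=; ring.
Qed.

Lemma square_corner a : closed_square R (corner R a).
Proof. by elim/ord4_ind: a; apply/squareP => -[]; rewrite /corner /co /=; lra. Qed.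

Lemma square_sidept a t : 0 <= t <= 1 -> closed_square R (sidept a t).
Proof. by move=> ht; apply: square_seg => //; exact: square_corner. Qed.

Lemma sidept_inj a s t : sidept a s = sidept a t -> s = t.
Proof.
rewrite !sideptE => /(congr1 (co (odd a))); rewrite !co_pt.
by case: ifP => _ //; lra.
Qed.

Lemma square_pt o x y : 0 <= x <= 1 -> 0 <= y <= 1 -> closed_square R (pt o x y).
Proof. by move=> hx hy; apply/squareP; case: o => -[]. Qed.

Lemma sidept_seg a s0 s1 t :
  segpt (sidept a s0) (sidept a s1) t = sidept a ((1 - t) * s0 + t * s1).
Proof.
by apply: co_inj => o; rewrite /sidept !co_segpt; ring.
Qed.

Lemma sidept_rev a s0 s1 t :
  segpt (sidept a (1 - s0)) (sidept a (1 - s1)) t =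
  sidept a (1 - ((1 - t) * s0 + t * s1)).
Proof. by rewrite sidept_seg; congr sidept; ring. Qed.

Lemma lenv_sidept a s t : lenv (sidept a s) (sidept a t) = `|s - t|.
Proof.
have e x y : `|1 - x - (1 - y)| = `|x - y| :> R by rewrite distrC; congr `|_|; ring.
by rewrite !sideptE /lenv /pt; case: (odd a); case: ifP => _ /=;
  rewrite subrr normr0 ?addr0 ?add0r ?e.
Qed.

Definition side_glue q a q' b : Prop :=
  forall t, 0 <= t <= 1 -> chart q (sidept a t) = chart q' (sidept b (1 - t)).

(** Charts overlap in faces only, so that points of different charts are
    identified along the boundary of the parameter square, where
    parametrizations by side points match up to reversal. *)
Lemma glue q q' u u' : q != q' -> closed_square R u -> closed_square R u' ->
  chart q u = chart q' u' ->
  (exists a b, u = corner R a /\ u' = corner R b) \/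
  (exists a b, side_glue q a q' b /\
    exists t, [/\ 0 <= t <= 1, u = sidept a t & u' = sidept b (1 - t)]).
Proof.
move=> qq' hu hu' E.
pose I := ((chart q @` closed_square R) `&` (chart q' @` closed_square R))%classic.
have hI : I (chart q u) by split; [exists u|exists u'].
case: (mesh_regular qq') => [e|[a [b [e eab]]]|[a [b [e eab]]]].
- by move: hI; rewrite /I e.
- left; exists a, b; move: hI; rewrite /I e => ec.
  split; first by apply: chart_inj ec => //; exact: square_corner.
  by apply: (@chart_inj q'); rewrite -?E -?eab //; exact: square_corner.
- right; exists a, b; split; first by move=> t ht; exact: eab.
  move: hI; rewrite /I e => -[_ [t /= ht <-] ec].
  have st := square_sidept a ht.
  exists t; split => //; first by apply: (@chart_inj q).
  apply: (@chart_inj q') => //; first by apply: square_sidept; lra.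
  by rewrite -E -ec; apply: eab.
Qed.

Lemma sidept_of a u v : closed_square R u -> closed_square R v ->
  (forall t, 0 < t < 1 -> exists2 s, 0 <= s <= 1 & segpt u v t = sidept a s) ->
  exists t0 t1, [/\ 0 <= t0 <= 1, 0 <= t1 <= 1, u = sidept a t0 & v = sidept a t1].
Proof.
move=> /squareP hu /squareP hv h.
pose c : R := (0 < a < 3)%N%:R.
have hc : (c <= co (~~ odd a) u <= c) /\ (c <= co (~~ odd a) v <= c).
  apply: open_seg_bounds => t /h[s hs E].
  by rewrite -co_segpt E sideptE co_ptN lexx.
have ex w : (c <= co (~~ odd a) w <= c) -> (forall o, 0 <= co o w <= 1) ->
    exists2 t, 0 <= t <= 1 & w = sidept a t.
  move=> hw /(_ (odd a)) sw.
  exists (if (a < 2)%N then co (odd a) w else 1 - co (odd a) w).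
    by case: ifP => _; lra.
  rewrite sideptE -[LHS](pt_co (odd a)); congr pt; last by rewrite -/c; lra.
  by case: (a < 2)%N => //; ring.
by have [t0 ? ?] := ex u hc.1 hu; have [t1 ? ?] := ex v hc.2 hv; exists t0, t1.
Qed.

Definition same_seg q u v q' u' v' : Prop :=
  forall t, 0 <= t <= 1 -> chart q (segpt u v t) = chart q' (segpt u' v' t).

Lemma arc_eq_same q o u v u' v' :
  closed_square R u -> closed_square R v -> closed_square R u' ->
  closed_square R v' -> co (~~ o) u = co (~~ o) v ->
  arc q u v = arc q u' v' -> (u' = u /\ v' = v) \/ (u' = v /\ v' = u).
Proof.
move=> hu hv hu' hv' huv E; apply: open_seg_inj huv _ _ => t ht.
  have /arcP : arc q u v (chart q (segpt u v t)) by apply/arcP; exists t.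
  move/predeqP: E => E0 /arcP /E0 /arcP [s hs e]; exists s => //.
  by apply: chart_inj e; apply: square_seg => //; exact: open_closed01.
have /arcP : arc q u' v' (chart q (segpt u' v' t)) by apply/arcP; exists t.
move/predeqP: E => E0 /arcP /E0 /arcP [s hs e]; exists s => //.
by apply: chart_inj e; apply: square_seg => //; exact: open_closed01.
Qed.

(** Within a chart the endpoints can be recovered from the points of the arc.
    An arc that two charts have in common lies in a shared side, along which it
    can be transported from one chart to the other. *)
Lemma arc_eq o q u v q' u' v' :
  closed_square R u -> closed_square R v -> closed_square R u' ->
  closed_square R v' -> u <> v -> co (~~ o) u = co (~~ o) v ->
  arc q u v = arc q' u' v' ->
  exists w z, [/\ (w = u' /\ z = v') \/ (w = v' /\ z = u'),
    lenv u v = lenv w z, same_seg q u v q' w z &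
    [/\ q = q', w = u & z = v] \/
    exists a b t0 t1, [/\ side_glue q a q' b, u = sidept a t0, v = sidept a t1,
       w = sidept b (1 - t0) & z = sidept b (1 - t1)]].
Proof.
move=> hu hv hu' hv' uv huv E.
case: (eqVneq q q') => [qq'|qq'].
  subst q'; exists u, v; split => //; last by left.
  by case: (arc_eq_same hu hv hu' hv' huv E) => -[-> ->]; [left|right].
pose I := ((chart q @` closed_square R) `&` (chart q' @` closed_square R))%classic.
have hI t : 0 < t < 1 -> I (chart q (segpt u v t)).
  move=> ht; split.
    by exists (segpt u v t) => //; apply: square_seg => //; exact: open_closed01.
  have : arc q u v (chart q (segpt u v t)) by apply/arcP; exists t.
  rewrite E => /arcP[s hs ->]; exists (segpt u' v' s) => //.
  by apply: square_seg => //; exact: open_closed01.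
case: (mesh_regular qq') => [e|[a [b [e eab]]]|[a [b [e eab]]]].
- by have := hI (1 / 2) ltac:(lra); rewrite /I e.
- have h2 := hI (1 / 2) ltac:(lra); have h3 := hI (1 / 3) ltac:(lra).
  move: h2 h3; rewrite /I e => <- /chart_inj h3.
  have /(segpt_inj uv) : segpt u v (1 / 3) = segpt u v (1 / 2).
    by apply: h3; apply: square_seg => //; lra.
  lra.
have [t0 [t1 [ht0 ht1 eu ev]]] : exists t0 t1,
    [/\ 0 <= t0 <= 1, 0 <= t1 <= 1, u = sidept a t0 & v = sidept a t1].
  apply: (sidept_of hu hv) => t ht; have := hI t ht.
  rewrite /I e => -[_ [s /= hs <-] ec]; exists s => //.
  apply: (@chart_inj q); [|exact: square_sidept|exact/esym].
  by apply: square_seg => //; exact: open_closed01.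
have sg : side_glue q a q' b by move=> t ht; exact: eab.
pose w := sidept b (1 - t0); pose z := sidept b (1 - t1).
have sq : same_seg q u v q' w z.
  move=> t ht; rewrite eu ev sidept_seg sidept_rev; apply: sg.
  exact: segpt_convex.
have sw : closed_square R w by apply: square_sidept; lra.
have sz : closed_square R z by apply: square_sidept; lra.
have E' : arc q' w z = arc q' u' v'.
  rewrite -E; apply/seteqP; split=> X /arcP[t ht ->]; apply/arcP; exists t => //.
    by rewrite sq //; exact: open_closed01.
  by rewrite -sq //; exact: open_closed01.
exists w, z; split => //; last by right; exists a, b, t0, t1.
- have hwz : co (~~ odd b) w = co (~~ odd b) z by rewrite /w /z !sideptE !co_ptN.
  by case: (arc_eq_same sw sz hu' hv' hwz E') => -[-> ->]; [left|right].
- by rewrite eu ev /w /z !lenv_sidept distrC; congr `|_|; ring.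
Qed.

(** The two halves and the midpoint of an arc depend only on its points. *)
Lemma arc_halves o q u v q' u' v' :
  closed_square R u -> closed_square R v -> closed_square R u' ->
  closed_square R v' -> u <> v -> co (~~ o) u = co (~~ o) v ->
  arc q u v = arc q' u' v' ->
  chart q (midpt u v) = chart q' (midpt u' v') /\
  ((arc q u (midpt u v) = arc q' u' (midpt u' v') /\
    arc q (midpt u v) v = arc q' (midpt u' v') v') \/
   (arc q u (midpt u v) = arc q' (midpt u' v') v' /\
    arc q (midpt u v) v = arc q' u' (midpt u' v'))).
Proof.
move=> hu hv hu' hv' uv huv E.
have [w [z [wz _ sq _]]] := arc_eq hu hv hu' hv' uv huv E.
have hm : chart q (midpt u v) = chart q' (midpt w z).
  by rewrite !midpt_seg sq //; lra.
have sq' : same_seg q v u q' z w.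
  by move=> t ht; rewrite -(segptC u) -(segptC w) sq //; lra.
have half (u1 v1 w1 z1 : R * R) : same_seg q u1 v1 q' w1 z1 ->
    arc q u1 (midpt u1 v1) = arc q' w1 (midpt w1 z1).
  move=> s1; apply/seteqP; split=> X /arcP[t ht ->]; apply/arcP; exists t => //.
    by rewrite !segpt_half s1 //; lra.
  by rewrite !segpt_half s1 //; lra.
have h1 := half _ _ _ _ sq; have h2 := half _ _ _ _ sq'.
rewrite (midptC v) (midptC z) in h2.
rewrite (arcC q (midpt u v)) hm.
case: wz => -[ew ez]; subst w z; first by split=> //; left; rewrite h1 h2 (arcC q' v').
by rewrite (midptC v' u') in h1 h2 *; split=> //; right; rewrite h1 h2 (arcC q' v').
Qed.

(** The choice made by mid is immaterial. *)
Lemma mid_arc o q u v : closed_square R u -> closed_square R v -> u <> v ->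
  co (~~ o) u = co (~~ o) v -> mid M0 (arc q u v) = chart q (midpt u v).
Proof.
move=> hu hv uv huv; rewrite /mid; case: xgetP => [X _|/(_ (chart q (midpt u v)))].
  by move=> [q' [u' [v' [hu' hv' E ->]]]]; have [] := arc_halves hu hv hu' hv' uv huv E.
by case; exists q, u, v.
Qed.

End Gluing.

(** * Dyadic boxes and the mesh metric *)

Section Chains.
Variables (R : realType) (d : nat) (M0 : quad_mesh R d).
Implicit Types (q : elt M0) (u v w : R * R) (t r : R) (X Y Z W : 'rV[R]_d).

Definition cbit (o : bool) (i : 'I_4) : bool :=
  if o then (1 < i)%N else (0 < i < 3)%N.

Lemma co_corner o i : co o (corner R i) = (cbit o i)%:R.
Proof. by elim/ord4_ind: i; case: o. Qed.

(** A box of level j is a closed dyadic square of side 2^-j, given by its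
    chart and its two indices. *)
Definition box : Type := (elt M0 * nat * nat)%type.
HB.instance Definition _ := Equality.on box.
Implicit Types (b c : box).

Definition idx b (o : bool) : nat := if o then b.2 else b.1.2.

Definition inbox (j : nat) b X : Prop :=
  (forall o, idx b o < 2 ^ j)%N /\
  exists2 u, X = chart b.1.1 u &
    forall o, (idx b o)%:R <= 2 ^+ j * co o u <= (idx b o).+1%:R.

Definition onmesh X : Prop := exists q u, closed_square R u /\ X = chart q u.

Definition gridpt (j : nat) (m : bool -> nat) : R * R :=
  ((m false)%:R / 2 ^+ j, (m true)%:R / 2 ^+ j).

Lemma co_gridpt j m o : co o (gridpt j m) = (m o)%:R / 2 ^+ j.
Proof. by case: o. Qed.

Lemma pow2_gt0 j : 0 < 2 ^+ j :> R.
Proof. by rewrite exprn_gt0. Qed.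

Lemma scale_gridpt j m o : 2 ^+ j * co o (gridpt j m) = (m o)%:R.
Proof. by rewrite co_gridpt mulrC divfK // lt0r_neq0 // pow2_gt0. Qed.

Lemma natr_pow2 j : (2 ^ j)%:R = 2 ^+ j :> R.
Proof. by rewrite natrX. Qed.

Lemma le_natR (m n : nat) : (m <= n)%N -> m%:R <= n%:R :> R.
Proof. by rewrite ler_nat. Qed.

Lemma inbox_square j b u : (forall o, idx b o < 2 ^ j)%N ->
  (forall o, (idx b o)%:R <= 2 ^+ j * co o u <= (idx b o).+1%:R) ->
  closed_square R u.
Proof.
move=> hb hu; apply/squareP => o; have /andP[h1 h2] := hu o.
have /le_natR := hb o; rewrite natr_pow2 => h3.
have := ler0n R (idx b o); have := pow2_gt0 j => p h0.
apply/andP; split; nra.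
Qed.

Lemma snap (i m : nat) (x : R) : i%:R <= x <= i.+1%:R -> `|x - m%:R| <= 1 / 2 :> R ->
  i%:R <= (m%:R : R) <= i.+1%:R.
Proof.
rewrite ler_norml => h1 h2; rewrite !ler_nat; apply/andP; split.
  rewrite leqNgt; apply/negP => /le_natR; rewrite -natr1; lra.
rewrite leqNgt; apply/negP => /le_natR; move: h1; rewrite -!natr1; lra.
Qed.

Lemma round_eq (n m : nat) : `|n%:R - m%:R| <= 1 / 2 :> R -> m = n.
Proof.
rewrite ler_norml => h; apply/eqP; rewrite eqn_leq; apply/andP; split;
  rewrite leqNgt; apply/negP => /le_natR; rewrite -natr1; lra.
Qed.

(** A box that contains a point also contains the grid points nearest to it,
    even if it belongs to another chart: two boxes meet in a common face. *)
Lemma rounding j q u (m : bool -> nat) b : closed_square R u ->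
  (forall o, `|2 ^+ j * co o u - (m o)%:R| <= 1 / 2 :> R) ->
  inbox j b (chart q u) -> inbox j b (chart q (gridpt j m)).
Proof.
move=> hu hm [hb [u' E hu']]; split=> //.
have su' := inbox_square hb hu'.
have [eq|neq] := eqVneq q b.1.1.
  exists (gridpt j m); first by rewrite eq.
  have uu' : u = u' by move: E; rewrite eq; exact: chart_inj.
  by move=> o; rewrite scale_gridpt; apply: snap (hm o); rewrite uu'.
have edge_eq o (e : bool) : co o u = e%:R -> (m o)%:R = 2 ^+ j * co o u.
  move=> h; rewrite h; have := hm o; rewrite h -natr_pow2 -natrM => /round_eq ->.
  by [].
case: (glue neq hu su' E) => [[a [a' [ea ea']]]|].
  exists u' => //; rewrite -E; congr (chart q _); apply: co_inj => o.
  have := @edge_eq o (cbit o a); rewrite ea co_corner co_gridpt => /(_ erefl) ->.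
  by rewrite mulrC mulKf // lt0r_neq0 // pow2_gt0.
case=> a [a' [sg [t [ht eu eu']]]].
pose s : R := (m (odd a))%:R / 2 ^+ j.
have p0 := pow2_gt0 j.
have hs : 2 ^+ j * s = (m (odd a))%:R by rewrite /s mulrC divfK // lt0r_neq0.
pose t' := if (a < 2)%N then s else 1 - s.
have cu : co (odd a) u = if (a < 2)%N then t else 1 - t.
  by rewrite eu sideptE co_pt.
have s01 : 0 <= s <= 1.
  have := hm (odd a); rewrite cu => hma.
  have m0 : 0 <= (m (odd a))%:R :> R by [].
  suff : (m (odd a) <= 2 ^ j)%N.
    by move/le_natR; rewrite natr_pow2 -hs; nra.
  rewrite leqNgt; apply/negP => /le_natR; rewrite -natr1 natr_pow2.
  by move: hma; rewrite ler_norml; case: (a < 2)%N; nra.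
have gE : gridpt j m = sidept a t'.
  rewrite sideptE; rewrite -[LHS](pt_co (odd a)); congr pt.
    by rewrite co_gridpt -/s /t'; case: (a < 2)%N => //; ring.
  have := @edge_eq (~~ odd a) (0 < a < 3)%N; rewrite eu sideptE co_ptN => /(_ erefl).
  by rewrite co_gridpt => ->; rewrite mulrC mulKf // lt0r_neq0.
have t'01 : 0 <= t' <= 1 by rewrite /t'; case: (a < 2)%N; lra.
exists (sidept a' (1 - t')); first by rewrite gE sg.
move=> o; have := hu' o; rewrite eu' !sideptE.
have [->|->] := axis_cases (odd a') o.
  rewrite !co_pt.
  have [n hn] : exists n : nat, 2 ^+ j * (if (a' < 2)%N then 1 - t' else 1 - (1 - t')) = n%:R.
    have [n1 [hn1]] : exists n1 : nat, (n1 <= 2 ^ j)%N /\ 2 ^+ j * s = n1%:R.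
      exists (m (odd a)); split=> //.
      by rewrite -(ler_nat R) -hs natr_pow2; nra.
    move=> e1.
    have [e2|e2] : (if (a' < 2)%N then 1 - t' else 1 - (1 - t')) = s \/
        (if (a' < 2)%N then 1 - t' else 1 - (1 - t')) = 1 - s.
      by rewrite /t'; case: (a' < 2)%N; case: (a < 2)%N; [right|left|left|right]; ring.
      by exists n1; rewrite e2.
    exists (2 ^ j - n1)%N; rewrite e2 natrB // natr_pow2 -e1; ring.
  rewrite hn => h; apply: (snap h); rewrite -hn.
  move: (hm (odd a)); rewrite cu -hs !ler_norml /t'.
  by case: (a < 2)%N; case: (a' < 2)%N; lra.
by rewrite !co_ptN.
Qed.

Definition parent b : box := (b.1.1, b.1.2./2, b.2./2).

Lemma idx_parent b o : idx (parent b) o = (idx b o)./2.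
Proof. by case: o. Qed.

Lemma inbox_parent j b X : inbox j.+1 b X -> inbox j (parent b) X.
Proof.
case=> hb [u -> hu]; split=> [ o|].
  by have := hb o; rewrite idx_parent expnS; lia.
exists u => // o; have := hu o; rewrite idx_parent exprS.
have := odd_double_half (idx b o); set h := _./2; case: (odd _) => /= <-.
  by rewrite -muln2 ?add1n ?add0n -!natr1 natrM; lra.
by rewrite -muln2 ?add1n ?add0n -!natr1 natrM; lra.
Qed.

Definition hop j X Y : Prop := exists2 b, inbox j b X & inbox j b Y.

(** A chain of n boxes is recorded by the points where it passes from one box to
    the next. With X = Y for n = 0, lengths are additive under concatenation. *)
Fixpoint links j n X Y : Prop :=
  if n is n'.+1 then exists2 Z, hop j X Z & links j n' Z Y else X = Y.

Lemma links_cat j m n X Y Z : links j m X Y -> links j n Y Z -> links j (m + n) X Z.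
Proof.
elim: m X => [|m IH] X /= => [-> //|[W hW h1] h2].
by exists W => //; exact: IH.
Qed.

Lemma hopC j X Y : hop j X Y -> hop j Y X.
Proof. by case=> b; exists b. Qed.

Lemma half_interval (i : nat) (x : R) : i%:R <= x <= i.+1%:R ->
  exists2 e : bool, ((2 * i + e)%N%:R <= 2 * x <= (2 * i + e).+1%:R) &
   ((2 * i + e)%N%:R <= ((2 * i + 1)%N%:R : R) <= (2 * i + e).+1%:R).
Proof.
rewrite -natr1 => h; exists (i%:R + 1 / 2 <= x); last first.
  by rewrite !ler_nat; case: (_ <= x); lia.
have E (e : bool) : ((2 * i + e)%N%:R : R) = 2 * i%:R + e%:R by rewrite natrD natrM.
by case: (leP (i%:R + 1 / 2) x) => h2; rewrite -natr1 E /=; lra.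
Qed.

Lemma box_exists j q u : closed_square R u ->
  exists2 b, inbox j b (chart q u) & b.1.1 = q.
Proof.
move=> /squareP hu.
have ex o : exists2 i : nat, (i < 2 ^ j)%N & i%:R <= 2 ^+ j * co o u <= i.+1%:R.
  elim: j => [|j [i hi /half_interval [e he _]]].
    by exists 0%N => //; rewrite expr0 mul1r; exact: hu.
  exists (2 * i + e)%N; last by rewrite exprS -mulrA.
  by rewrite expnS; case: e {he}; lia.
have [i hi ei] := ex false; have [k hk ek] := ex true.
by exists (q, i, k) => //; split=> [[]//|]; exists u => // -[].
Qed.

Lemma hop_refl j X : onmesh X -> hop j X X.
Proof. by case=> q [u [hu ->]]; have [b hb _] := box_exists j q hu; exists b. Qed.

Lemma links_pad j m n X Y : onmesh X -> (m <= n)%N -> links j m X Y -> links j n X Y.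
Proof.
move=> hX mn h; rewrite -(subnK mn); apply: links_cat h.
by elim: (n - m)%N => [//|k IH]; exists X => //; exact: hop_refl.
Qed.

(** Both ends lie in quarters of the box, and all quarters contain its center. *)
Lemma hop_refine j X Y : hop j X Y -> links j.+1 2 X Y.
Proof.
case=> b hX hY; pose C := chart b.1.1 (gridpt j.+1 (fun o => 2 * idx b o + 1)%N).
suff half W : inbox j b W -> hop j.+1 W C.
  by exists C; [exact: half|exists Y => //; apply/hopC/half].
case=> hb [u -> hu].
have [e0 h0 c0] := half_interval (hu false); have [e1 h1 c1] := half_interval (hu true).
pose c : box := (b.1.1, 2 * idx b false + e0, 2 * idx b true + e1)%N.
have hc o : (idx c o < 2 ^ j.+1)%N.
  have /= := hb o; rewrite expnS; case: o; rewrite /c /idx /=.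
    by case: (e1); lia.
  by case: (e0); lia.
exists c; split=> //.
  by exists u => // -[]; rewrite exprS -mulrA.
by exists (gridpt j.+1 (fun o => 2 * idx b o + 1)%N) => // -[]; rewrite scale_gridpt.
Qed.

Lemma links_refine j k n X Y : links j n X Y -> links (j + k) (n * 2 ^ k) X Y.
Proof.
elim: k => [|k IH] h; first by rewrite addn0 expn0 muln1.
rewrite addnS expnS mulnCA; move: (IH h).
elim: (n * 2 ^ k)%N X {h IH} => [//|m IH] X [Z hZ h]; rewrite mulnS.
by apply: links_cat (hop_refine hZ) (IH _ h).
Qed.

(** Let c1, c2, c3 be consecutive small boxes. The vertex that c2 shares with
    its parent is the grid point nearest to both ends of the passage through
    c2, hence it lies in the parents of c1 and c3, and the parent of c2 can be
    skipped. *)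
Lemma links_skip j m X Y b W : inbox j.+1 b X -> links j.+1 (2 * m) X Y ->
  inbox j (parent b) W -> links j m.+1 W Y.
Proof.
elim: m X b W => [|m IH] X b W hb.
  by move=> /= <- hW; exists X => //; exists (parent b) => //; exact: inbox_parent.
rewrite mulnS => -[X2 [c2 h1 h2] [X3 [c3 h3 h4] h5]] hW.
pose m2 o := uphalf (idx c2 o).
pose Z := chart c2.1.1 (gridpt j m2).
have near V b' : inbox j.+1 c2 V -> inbox j b' V -> inbox j b' Z.
  case=> hc [u -> hu]; apply: rounding; first exact: inbox_square hu.
  move=> o; have := hu o; rewrite exprS /m2.
  have /(congr1 (fun n => n%:R : R)) : (2 * uphalf (idx c2 o) = idx c2 o + odd (idx c2 o))%N.
    by rewrite uphalfE; lia.
  rewrite natrM natrD ler_norml -[(idx c2 o).+1%:R]natr1.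
  by case: (odd _) => /= e; lra.
have Z1 : inbox j (parent b) Z by apply: near h1 _; exact: inbox_parent.
have Z3 : inbox j (parent c3) Z by apply: near h2 _; exact: inbox_parent.
exists Z; first by exists (parent b).
exact: IH h4 h5 Z3.
Qed.

(** By skipping every other parent, 2 T + 1 boxes turn into T + 1; the summand 1
    therefore does not accumulate over the levels. *)
Lemma links_coarsen j k S n X Y : onmesh X -> (n <= S * 2 ^ k + 1)%N ->
  links (j + k) n X Y -> links j S.+1 X Y.
Proof.
move=> hX; elim: k n => [|k IH] n.
  by rewrite addn0 muln1 addn1; exact: links_pad.
move=> hn; rewrite addnS => /(links_pad hX hn) h.
apply: (IH (S * 2 ^ k + 1)%N) => //; move: h.
rewrite addn1 expnS mulnCA => -[Z [b h1 h2] h].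
by rewrite addn1; apply: links_skip h2 h _; exact: inbox_parent.
Qed.

(** The mesh metric, as the relation that the distance is at most r. The level of
    the chain is arbitrary because chains can be refined without loss. *)
Definition close r X Y : Prop :=
  exists j n, links j n X Y /\ n%:R <= r * 2 ^+ j.

Lemma close_refl r X : 0 <= r -> close r X X.
Proof. by move=> r0; exists 0%N, 0%N; split=> //; rewrite mulr1. Qed.

Lemma close_le r s X Y : r <= s -> close r X Y -> close s X Y.
Proof.
move=> rs [j [n [h hn]]]; exists j, n; split=> //; apply: le_trans hn _.
by rewrite ler_wpM2r // ltW // pow2_gt0.
Qed.

Lemma close_trans r s X Y Z : close r X Y -> close s Y Z -> close (r + s) X Z.
Proof.
move=> [j [n [h hn]]] [k [m [h' hm]]]; exists (j + k)%N, (n * 2 ^ k + m * 2 ^ j)%N.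
split; first by apply: links_cat (links_refine k h) _; rewrite addnC; exact: links_refine.
rewrite natrD !natrM !natr_pow2 exprD.
have := pow2_gt0 j; have := pow2_gt0 k; nra.
Qed.

Lemma close_hop j X Y : hop j X Y -> close (2 ^- j) X Y.
Proof.
move=> h; exists j, 1%N; split; first by exists Y.
by rewrite mulVf // lt0r_neq0 // pow2_gt0.
Qed.

(** On the scale of a level, closeness can be tested with boxes of that level. *)
Lemma close_links l S X Y : onmesh X -> close (S%:R / 2 ^+ l) X Y -> links l S.+1 X Y.
Proof.
move=> hX [j [n [h hn]]]; case: (leqP l j) => lj.
  apply: (@links_coarsen l (j - l) S n) => //; last by rewrite subnKC.
  rewrite addn1; apply: leqW; rewrite -(ler_nat R) natrM natr_pow2; apply: le_trans hn _.
  by rewrite -{1}(subnKC lj) exprD mulrA divfK // lt0r_neq0 // pow2_gt0.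
have := links_refine (l - j) h; rewrite subnKC; last exact: ltnW.
move=> h2; apply: links_pad h2 => //; apply: leqW; rewrite -(ler_nat R) natrM natr_pow2.
have := hn; rewrite -(subnKC (ltnW lj)); set k := (l - j)%N.
rewrite addKn exprD invfM => hn'.
have := pow2_gt0 j; have := pow2_gt0 k; move: hn'.
set A := 2 ^+ j; set B := 2 ^+ k => hn' B0 A0.
have e : S%:R = (S%:R * (A^-1 * B^-1) * A) * B by field; rewrite !lt0r_neq0.
by rewrite e ler_wpM2r // ltW.
Qed.

End Chains.

(** * Packing of boxes *)

Section Packing.
Variables (R : realType) (d : nat) (M0 : quad_mesh R d).
Implicit Types (q : elt M0) (X Y Z : 'rV[R]_d) (b c : box M0) (o : bool).

Lemma size_flatten_le (T U : Type) (f : T -> seq U) (s : seq T) (K : nat) :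
  (forall x, size (f x) <= K)%N -> (size (flatten (map f s)) <= size s * K)%N.
Proof.
by move=> h; elim: s => //= x s IH; rewrite size_cat mulSn leq_add.
Qed.

(** Two boxes of the same chart through a common point have indices that
    differ by at most 1, so their parities tell them apart. *)
Lemma boxes_at j X : exists2 s : seq (box M0),
  (size s <= 4 * #|elt M0|)%N & forall b, inbox j b X -> b \in s.
Proof.
pose code b := (b.1.1, odd b.1.2, odd b.2).
pose pick (z : elt M0 * bool * bool) : box M0 :=
  xget (z.1.1, 0%N, 0%N) [set b | inbox j b X /\ code b = z].
exists [seq pick z | z <- enum {: elt M0 * bool * bool}].
  by rewrite size_map -cardE !card_prod card_bool -mulnA mulnC.
move=> b hb; suff -> : b = pick (code b) by apply/map_f/mem_enum.
rewrite /pick; case: xgetP => [c _ [hc ec]|/(_ b)]; last by case.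
case: hb hc => [hb [u eu hu]] [hc [v ev hv]].
case: b c ec hb eu hu hc ev hv => [[q i] k] [[q' i'] k'] [<- e1 e2] hb eu hu hc ev hv.
have uv : u = v.
  apply: (@chart_inj _ _ _ q'); last exact: etrans (esym eu) ev.
    exact: inbox_square hu.
  exact: inbox_square hv.
have gen (m n : nat) (x : R) : m%:R <= x <= m.+1%:R -> n%:R <= x <= n.+1%:R ->
    odd m = odd n -> m = n.
  move=> h1 h2; have : (m <= n.+1)%N by rewrite -(ler_nat R); lra.
  have : (n <= m.+1)%N by rewrite -(ler_nat R); lra.
  lia.
rewrite (gen i i' (2 ^+ j * u.1)) //; last by rewrite uv; exact: (hv false).
  rewrite (gen k k' (2 ^+ j * u.2)) //; last by rewrite uv; exact: (hv true).
  exact: (hu true).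
exact: (hu false).
Qed.

Lemma near_end (i : nat) (x : R) : i%:R <= x <= i.+1%:R ->
  exists e : bool, `|x - (i + e)%N%:R| <= 1 / 2 :> R.
Proof.
rewrite -natr1 => h; exists (i%:R + 1 / 2 <= x).
by rewrite ler_norml natrD; case: (leP (i%:R + 1 / 2) x) => /= h2; lra.
Qed.

(** A box that touches c contains, by rounding, a vertex of c. *)
Lemma touching_boxes j c : exists2 s : seq (box M0),
  (size s <= 16 * #|elt M0|)%N &
  forall X b, inbox j c X -> inbox j b X -> b \in s.
Proof.
pose V (e : bool * bool) :=
  chart c.1.1 (gridpt R j (fun o => idx c o + if o then e.2 else e.1)%N).
have /choice[f fP] (e : bool * bool) : exists s : seq (box M0),
    (size s <= 4 * #|elt M0|)%N /\ forall b, inbox j b (V e) -> b \in s.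
  by have [s s1 s2] := boxes_at j (V e); exists s.
exists (flatten (map f (enum {: bool * bool}))).
  apply: leq_trans (size_flatten_le _ _) _; first by move=> e; have [] := fP e; eauto.
  by rewrite -cardE card_prod card_bool mulnA.
move=> X b [hc [u -> hu]] hb.
have [e0 he0] := near_end (hu false); have [e1 he1] := near_end (hu true).
apply/flattenP; exists (f (e0, e1)); first exact/map_f/mem_enum.
apply: (fP _).2; apply: rounding hb; first exact: inbox_square hu.
by case.
Qed.

Lemma reachable_boxes j n c : exists2 s : seq (box M0),
  (size s <= (16 * #|elt M0|) ^ n.+1)%N &
  forall X Y b, inbox j c X -> links M0 j n X Y -> inbox j b Y -> b \in s.
Proof.
elim: n c => [|n IH] c; have [t st ht] := touching_boxes j c.
  by exists t => // X Y b hX /= <-; exact: ht.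
have /choice[f fP] b : exists s : seq (box M0),
    (size s <= (16 * #|elt M0|) ^ n.+1)%N /\ forall X Y b', inbox j b X ->
      links M0 j n X Y -> inbox j b' Y -> b' \in s.
  by have [s s1 s2] := IH b; exists s.
exists (flatten (map f t)).
  rewrite expnS; apply: leq_trans (size_flatten_le _ _) _.
    by move=> e; have [] := fP e; eauto.
  by rewrite leq_mul2r st orbT.
move=> X Y b hX [Z [b' h1 h2] h] hb.
apply/flattenP; exists (f b'); first exact/map_f/(ht X).
exact: (fP b').2 h2 h hb.
Qed.

End Packing.

(** * Dyadic edges *)

Section DyadicEdges.
Variables (R : realType) (d : nat) (M0 : quad_mesh R d).
Variable di : set 'rV[R]_d -> nat.
Implicit Types (q : elt M0) (u v : R * R) (x y : R) (X Y : 'rV[R]_d) (o : bool).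
Implicit Types (a n m : nat) (F G : edge R d).

Definition seg q o a n y : set 'rV[R]_d :=
  arc q (pt o (n%:R / 2 ^+ a) y) (pt o (n.+1%:R / 2 ^+ a) y).

Lemma pow2_neq0 a : 2 ^+ a != 0 :> R.
Proof. by rewrite lt0r_neq0 // pow2_gt0. Qed.

Lemma grid_split a n : n%:R / 2 ^+ a = (2 * n)%:R / 2 ^+ a.+1 :> R.
Proof. by rewrite natrM exprS; field; rewrite pow2_neq0. Qed.

Lemma grid_bounds a n : (n <= 2 ^ a)%N -> 0 <= (n%:R / 2 ^+ a : R) <= 1.
Proof.
move=> /(le_natR R); rewrite natr_pow2 => h.
by rewrite divr_ge0 ?ler_pdivrMr ?mul1r ?h // ?ltW // pow2_gt0.
Qed.

Lemma seg_square q o a n y : (n < 2 ^ a)%N -> 0 <= y <= 1 ->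
  closed_square R (pt o (n%:R / 2 ^+ a) y) /\
  closed_square R (pt o (n.+1%:R / 2 ^+ a) y).
Proof. by move=> hn hy; split; apply: square_pt => //; apply: grid_bounds; lia. Qed.

Lemma seg_ends a n : (n%:R / 2 ^+ a : R) < n.+1%:R / 2 ^+ a.
Proof. by rewrite ltr_pM2r ?invr_gt0 ?pow2_gt0 // ltr_nat. Qed.

Lemma seg_neq o a n y : pt o (n%:R / 2 ^+ a) y <> pt o (n.+1%:R / 2 ^+ a) y.
Proof. by move=> /(congr1 (co o)); rewrite !co_pt; have := seg_ends a n; lra. Qed.

Lemma seg_axis o a n y :
  co (~~ o) (pt o (n%:R / 2 ^+ a) y) = co (~~ o) (pt o (n.+1%:R / 2 ^+ a) y).
Proof. by rewrite !co_ptN. Qed.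

Lemma seg_mid o a n y :
  midpt (pt o (n%:R / 2 ^+ a) y) (pt o (n.+1%:R / 2 ^+ a) y) =
  pt o ((2 * n + 1)%N%:R / 2 ^+ a.+1) y.
Proof.
have e : (n%:R / 2 ^+ a + n.+1%:R / 2 ^+ a) / 2 = (2 * n + 1)%N%:R / 2 ^+ a.+1 :> R.
  by rewrite -natr1 natrD natrM exprS; field; rewrite pow2_neq0.
have e2 : (y + y) / 2 = y by field.
by case: o; rewrite /midpt /pt /= e e2.
Qed.

Lemma segP q o a n y X :
  seg q o a n y X <->
  exists2 x, n%:R < 2 ^+ a * x < n.+1%:R & X = chart q (pt o x y).
Proof.
have p0 := pow2_gt0 R a; have E k : 2 ^+ a * (k / 2 ^+ a) = k :> R.
  by rewrite mulrC divfK // pow2_neq0.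
have P t : segpt (pt o (n%:R / 2 ^+ a) y) (pt o (n.+1%:R / 2 ^+ a) y) t =
    pt o ((n%:R + t) / 2 ^+ a) y.
  rewrite -[LHS](pt_co o) !co_segpt !co_pt !co_ptN -natr1; congr pt; last ring.
  by field; rewrite pow2_neq0.
split=> [/arcP[t ht ->]|[x hx ->]]; last apply/arcP.
  by exists ((n%:R + t) / 2 ^+ a); rewrite ?P // E -natr1; lra.
exists (2 ^+ a * x - n%:R); first by rewrite -natr1 in hx; lra.
by rewrite P addrC subrK mulrC mulKf ?pow2_neq0.
Qed.

Lemma seg_mid_chart q o a n y : (n < 2 ^ a)%N -> 0 <= y <= 1 ->
  mid M0 (seg q o a n y) = chart q (pt o ((2 * n + 1)%N%:R / 2 ^+ a.+1) y).
Proof.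
move=> hn hy; have [h1 h2] := seg_square q o hn hy.
by rewrite (mid_arc q h1 h2 (@seg_neq o a n y) (seg_axis o a n y)) seg_mid.
Qed.

Lemma seg_halves q o a n y :
  arc q (pt o (n%:R / 2 ^+ a) y)
     (midpt (pt o (n%:R / 2 ^+ a) y) (pt o (n.+1%:R / 2 ^+ a) y)) =
    seg q o a.+1 (2 * n) y /\
  arc q (midpt (pt o (n%:R / 2 ^+ a) y) (pt o (n.+1%:R / 2 ^+ a) y))
     (pt o (n.+1%:R / 2 ^+ a) y) = seg q o a.+1 (2 * n + 1) y.
Proof.
have e : (2 * n.+1 = (2 * n + 1).+1)%N by lia.
by rewrite seg_mid /seg !(grid_split a) e; split=> //; rewrite -[(2 * n).+1]addn1.
Qed.

Definition dirq q o : nat := di (side (cell0 q) (if o then 1 else 0)).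

Hypothesis diP : direction_labeling M0 di.

Lemma dirq_side q (i : 'I_4) : di (side (cell0 q) i) = dirq q (odd i).
Proof.
have e i1 i2 : val i1 = val i2 -> side (cell0 q) i1 = side (cell0 q) i2.
  by move=> /val_inj ->.
rewrite /dirq; elim/ord4_ind: i => /=.
- by congr di; exact: e.
- by congr di; exact: e.
- by rewrite (diP q 0).1; congr di; exact: e.
- by rewrite (diP q 1).1; congr di; exact: e.
Qed.

Lemma dirq_neq q o : dirq q o != dirq q (~~ o).
Proof.
have [_] := diP q 0; rewrite add0r => h; apply/eqP.
by case: o; [exact: nesym h|exact: h].
Qed.

Lemma side_cell0 q (i : 'I_4) : side (cell0 q) i = arc q (corner R i) (corner R (i + 1)).
Proof. by rewrite /side /cell0 /= !ffunE. Qed.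

Lemma side_glueE q (a : 'I_4) q' (b : 'I_4) :
  side_glue q a q' b -> side (cell0 q) a = side (cell0 q') b.
Proof.
move=> h; rewrite !side_cell0; apply/seteqP.
split=> X /arcP[t ht ->]; apply/arcP; exists (1 - t); rewrite ?subr_gt0 ?gtrBl 1?andbC //.
  by apply: h; exact: open_closed01.
have := h (1 - t); rewrite /sidept opprB addrCA subrr addr0 => <- //.
by apply: open_closed01; rewrite subr_gt0 gtrBl andbC.
Qed.

Lemma pow2_inj a a' : 2 ^+ a = 2 ^+ a' :> R -> a = a'.
Proof.
move=> /eqP; rewrite -!natr_pow2 eqr_nat => /eqP; exact: expnI.
Qed.

Lemma lenv_seg o a n y :
  lenv (pt o (n%:R / 2 ^+ a) y) (pt o (n.+1%:R / 2 ^+ a) y) = 2 ^- a.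
Proof.
have e : `|n%:R / 2 ^+ a - n.+1%:R / 2 ^+ a| = 2 ^- a :> R.
  rewrite distrC gtr0_norm ?subr_gt0 ?seg_ends // -natr1.
  by rewrite mulrDl mul1r addrAC subrr add0r.
by rewrite /lenv; case: o => /=; rewrite subrr normr0 ?addr0 ?add0r e.
Qed.

(** Gluing preserves lengths, hence levels. It matches sides with sides, and the
    direction labeling is constant along each axis of a chart and depends only
    on the points of the initial edges, hence directions agree as well. *)
Lemma seg_eq q o a n y q' o' a' n' y' :
  (n < 2 ^ a)%N -> 0 <= y <= 1 -> (n' < 2 ^ a')%N -> 0 <= y' <= 1 ->
  seg q o a n y = seg q' o' a' n' y' ->
  [/\ a = a', dirq q o = dirq q' o' & q = q' -> o = o' /\ y = y'].
Proof.
move=> hn hy hn' hy'.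
have [h1 h2] := seg_square q o hn hy; have [h3 h4] := seg_square q' o' hn' hy'.
have := seg_axis o a n y; have := @seg_neq o a n y.
have := lenv_seg o a n y; have := lenv_seg o' a' n' y'.
have := seg_axis o' a' n' y'; have := @seg_neq o' a' n' y'.
rewrite /seg; move: h1 h2 h3 h4.
set u := pt o _ y; set v := pt o _ y; set u' := pt o' _ y'; set v' := pt o' _ y'.
move=> h1 h2 h3 h4 neq' ax' l' l neq ax E.
have axis1 (e e' : bool) (w z : R * R) : w <> z -> co (~~ e) w = co (~~ e) z ->
    co (~~ e') w = co (~~ e') z -> e = e'.
  by move=> wz e1 e2; apply: contrapT => ee; apply: wz; apply: co_inj => -[];
    case: (e) (e') ee e1 e2 => [] [].
have [w [z [wz lw _ hq]]] := arc_eq h1 h2 h3 h4 neq ax E.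
have lwz : lenv w z = lenv u' v' by case: wz => -[-> ->] //; rewrite lenvC.
have axwz : co (~~ o') w = co (~~ o') z by case: wz => -[-> ->].
have nwz : w <> z by case: wz => -[-> ->] //; exact: nesym.
have aa : a = a'.
  by apply: pow2_inj; apply: invr_inj; rewrite -l -l' lw lwz.
have same : q = q' -> o = o' /\ y = y'.
  move=> qq; subst q'.
  have same := arc_eq_same h1 h2 h3 h4 ax E.
  have ei : o = o'.
    by case: same => -[ew ez]; apply: (axis1 o o' u v neq ax); rewrite -ew -ez.
  split=> //; case: same => -[ew _]; have := congr1 (co (~~ o)) ew.
    by rewrite co_ptN => <-; rewrite ei co_ptN.
  by rewrite co_ptN => <-; rewrite ei co_ptN.
split=> //; case: hq => [[qq _ _]|[a1 [b1 [t0 [t1 [sg eu ev ew ez]]]]]].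
  by have [-> _] := same qq; rewrite qq.
have -> : o = odd a1 by apply: (axis1 _ _ u v) => //; rewrite eu ev !sideptE !co_ptN.
have -> : o' = odd b1 by apply: (axis1 _ _ w z) => //; rewrite ew ez !sideptE !co_ptN.
by rewrite -!dirq_side (side_glueE sg).
Qed.

Definition dyedge q o a n m : edge R d :=
  Edge (seg q o a n (m%:R / 2 ^+ a.+1)) a (dirq q o).

(** The transverse coordinate may need one more binary digit than the level of
    the edge: a cut through an element whose sides have equal levels runs half
    way between two lines of the grid of its own level. *)
Definition dyadic F : Prop := exists q o n m,
  [/\ (n < 2 ^ level F)%N, (m <= 2 ^ (level F).+1)%N & F = dyedge q o (level F) n m].

Definition emid F : 'rV[R]_d := mid M0 (pts F).

Definition emidx o n m : bool -> nat := fun o' => if o' == o then (2 * n + 1)%N else m.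

Lemma pt_gridpt o j (k : bool -> nat) :
  pt o ((k o)%:R / 2 ^+ j) ((k (~~ o))%:R / 2 ^+ j) = gridpt R j k.
Proof. by case: o. Qed.

Lemma emid_dyedge q o a n m : (n < 2 ^ a)%N -> (m <= 2 ^ a.+1)%N ->
  emid (dyedge q o a n m) = chart q (gridpt R a.+1 (emidx o n m)).
Proof.
move=> hn hm; rewrite /emid seg_mid_chart //; last exact: grid_bounds.
by rewrite -(pt_gridpt o) /emidx eqxx; case: (o).
Qed.

Lemma gridpt_square j (k : bool -> nat) : (forall o, k o <= 2 ^ j)%N ->
  closed_square R (gridpt R j k).
Proof. by move=> h; apply/squareP => o; rewrite co_gridpt; exact: grid_bounds. Qed.

Lemma emidx_le o a n m : (n < 2 ^ a)%N -> (m <= 2 ^ a.+1)%N ->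
  forall o', (emidx o n m o' <= 2 ^ a.+1)%N.
Proof. by move=> hn hm o'; rewrite /emidx; case: ifP => _ //; rewrite expnS; lia. Qed.

Lemma emid_onmesh F : dyadic F -> onmesh M0 (emid F).
Proof.
case=> q [ o [n [m [hn hm ->]]]]; rewrite emid_dyedge //; exists q; eexists; split=> //.
by apply: gridpt_square; exact: emidx_le.
Qed.

(** Across the box, an edge of level l may run along either boundary line or half
    way in between. *)
Definition edges_in (l : nat) (b : box M0) : seq (edge R d) :=
  [seq dyedge b.1.1 o l (idx b o) (2 * idx b (~~ o) + r)
     | o <- [:: false; true], r <- [:: 0; 1; 2]%N].

Lemma edges_inP l F : dyadic F -> level F = l ->
  exists2 b : box M0, inbox l b (emid F) & F \in edges_in l b.
Proof.
move=> hF <-; case: (hF) => q [ o [n [m [hn hm EF]]]].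
have sq := gridpt_square (emidx_le o hn hm).
have E : emid F = chart q (gridpt R (level F).+1 (emidx o n m)).
  by rewrite {1}EF emid_dyedge.
have [b' hb' bq] := box_exists (level F) q sq.
exists b'; first by rewrite E.
case: (hb') => _ [u]; rewrite bq => /chart_inj eu hu.
have {}eu : gridpt R (level F).+1 (emidx o n m) = u.
  by apply: eu => //; case: (hb') => ? _; exact: inbox_square hu.
have h o' : (idx b' o' * 2 <= emidx o n m o' <= (idx b' o').+1 * 2)%N.
  have := hu o'; rewrite -eu co_gridpt exprS => h1.
  rewrite -!(ler_nat R) !natrM.
  have e : 2 ^+ level F * ((emidx o n m o')%:R / (2 * 2 ^+ level F)) =
    (emidx o n m o')%:R / 2 :> R by field; rewrite pow2_neq0.
  by move: h1; rewrite e; lra.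
have h1 := h o; have h2 := h (~~ o); move: h1 h2; rewrite /emidx eqxx.
have -> : (~~ o == o) = false by case: (o).
move=> h1 h2; have en : idx b' o = n by lia.
apply/allpairsP; exists (o, m - 2 * idx b' (~~ o))%N; split=> /=.
- by case: (o).
- have : (m - 2 * idx b' (~~ o) <= 2)%N by lia.
  by case: (m - _)%N => [|[|[|]]].
- by rewrite {1}EF bq en subnKC //; lia.
Qed.

(** Every edge of level l has its midpoint in one of boundedly many boxes of
    level l, and boundedly many edges are attached to each box. *)
Lemma packing (S : nat) : exists K : nat, forall l X, onmesh M0 X ->
  exists2 s : seq (edge R d), (size s <= K)%N & forall F, dyadic F ->
    level F = l -> close M0 (S%:R / 2 ^+ l) X (emid F) -> F \in s.
Proof.
exists ((16 * #|elt M0|) ^ S.+2 * 6)%N => l X hX.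
have [b0 hb0] : exists b0 : box M0, inbox l b0 X.
  by case: hX => q [u [hu ->]]; have [b0 ? _] := box_exists l q hu; exists b0.
have [s hs sP] := reachable_boxes l S.+1 b0.
exists (flatten (map (edges_in l) s)).
  have h6 b : (size (edges_in l b) <= 6)%N by rewrite size_allpairs.
  apply: leq_trans (size_flatten_le s h6) _.
  by rewrite leq_mul2r hs orbT.
move=> F hF lF /(close_links hX) h.
have [b hb Fb] := edges_inP hF lF.
apply/flattenP; exists (edges_in l b) => //; apply: map_f.
exact: sP hb0 h hb.
Qed.

End DyadicEdges.

(** * Rectangles and uniform refinements *)

Section Rectangles.
Variables (R : realType) (d : nat) (M0 : quad_mesh R d).
Implicit Types (q : elt M0) (u v : R * R) (x y r : R) (X Y A B : 'rV[R]_d) (o e : bool).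
Implicit Types (a n k : bool -> nat) (i : 'I_4) (j m : nat) (c : cell M0).

(** The rectangle with side 2^-(a o) and index n o along the axis o. *)
Definition rect q a n : cell M0 :=
  (q, [ffun i => ((n false + cbit false i)%:R / 2 ^+ a false,
                  (n true + cbit true i)%:R / 2 ^+ a true)]).

Lemma co_rect q a n i o :
  co o ((rect q a n).2 i) = (n o + cbit o i)%:R / 2 ^+ a o.
Proof. by rewrite ffunE; case: o. Qed.

Lemma rect_ext q a n a' n' : (forall o, a o = a' o) -> (forall o, n o = n' o) ->
  rect q a n = rect q a' n'.
Proof. by move=> ha hn; congr pair; apply/ffunP => i; rewrite !ffunE !ha !hn. Qed.

Lemma rect_inj q a n q' a' n' : rect q a n = rect q' a' n' ->
  [/\ q = q', forall o, a o = a' o & forall o, n o = n' o].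
Proof.
move=> E; have qq : q = q' by exact: (congr1 fst E).
have nn o : (n o)%:R / 2 ^+ a o = (n' o)%:R / 2 ^+ a' o :> R /\
    (n o).+1%:R / 2 ^+ a o = (n' o).+1%:R / 2 ^+ a' o :> R.
  have e2 (i : 'I_4) : co o ((rect q a n).2 i) = co o ((rect q' a' n').2 i) by rewrite E.
  have b0 : cbit o ord0 = false by case: (o).
  have b2 : cbit o (ord0 + 2) = true by case: (o).
  by have := e2 ord0; have := e2 (ord0 + 2); rewrite !co_rect b0 b2 !addn0 !addn1.
have aa o : a o = a' o.
  apply: (@pow2_inj R); apply: invr_inj; have [e1 e2] := nn o.
  have : (n o).+1%:R / 2 ^+ a o - (n o)%:R / 2 ^+ a o =
         (n' o).+1%:R / 2 ^+ a' o - (n' o)%:R / 2 ^+ a' o :> R by rewrite e1 e2.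
  by rewrite -!mulrBl -!natr1 ![_ + 1]addrC !addrK !mul1r.
split=> // o; have [+ _] := nn o; rewrite aa.
move=> /(congr1 (fun x => x * 2 ^+ a' o)); rewrite !divfK ?pow2_neq0 // => /eqP.
by rewrite eqr_nat => /eqP.
Qed.

Lemma cell_eq q (f g : {ffun 'I_4 -> R * R}) :
  (forall i o, co o (f i) = co o (g i)) -> (q, f) = (q, g) :> cell M0.
Proof. by move=> h; congr pair; apply/ffunP => i; apply: co_inj => o. Qed.

Lemma side_rect q a n i :
  side (rect q a n) i = seg q (odd i) (a (odd i)) (n (odd i))
    ((n (~~ odd i) + cbit (~~ odd i) i)%:R / 2 ^+ a (~~ odd i)).
Proof.
by elim/ord4_ind: i; rewrite /side /seg !ffunE /= ?addn0 ?addn1 // arcC.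
Qed.

Lemma half_pow2 j : 2 ^- j.+1 = 2 ^- j / 2 :> R.
Proof. by rewrite exprS invfM mulrC. Qed.

Lemma cut_rect q a n i :
  cut (rect q a n) i = seg q (~~ odd i) (a (~~ odd i)) (n (~~ odd i))
    ((2 * n (odd i) + 1)%N%:R / 2 ^+ (a (odd i)).+1).
Proof.
have e1 (z : nat) (w : R) : ((z + 0)%N%:R * w + (z + 1)%N%:R * w) / 2 =
    (2 * z + 1)%N%:R * (w / 2).
  by rewrite addn0 (natrD _ (2 * z)) (natrD _ z) natrM; field.
have e2 (z : nat) (w : R) : ((z + 1)%N%:R * w + (z + 0)%N%:R * w) / 2 =
    (2 * z + 1)%N%:R * (w / 2) by rewrite addrC e1.
have e3 (z : nat) (w : R) : (z%:R * w + z%:R * w) / 2 = z%:R * w by field.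
elim/ord4_ind: i; rewrite /cut /seg /rect /midpt !ffunE /= half_pow2 ?e1 ?e2 ?e3 ?addn0 ?addn1 //;
  by rewrite arcC.
Qed.

Definition sel o (x y : nat) : bool -> nat := fun o' => if o' == o then x else y.

Lemma sel1 o (x y : nat) : sel o x y o = x.
Proof. by rewrite /sel eqxx. Qed.
Lemma selN o (x y : nat) : sel o x y (~~ o) = y.
Proof. by rewrite /sel; case: o. Qed.

Lemma sel_forall o (x y : nat) (P : bool -> nat -> Prop) :
  P o x -> P (~~ o) y -> forall o', P o' (sel o x y o').
Proof. by rewrite /sel; case: o => hx hy [] /=. Qed.

(** Levels and indices of the halves of a rectangle along the axis o. *)
Definition hlev a o := sel o (a o).+1 (a (~~ o)).
Definition hidx n o e := sel o (2 * n o + e)%N (n (~~ o)).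

(** All corners of a half or a quarter of a rectangle are instances of this
    formula, with w the side of the rectangle along one axis. *)
Lemma grid_child (z : nat) (e e' : bool) (w : R) :
  (2 * z + e + e')%N%:R * (w / 2) = ((z + e)%N%:R * w + (z + e')%N%:R * w) / 2.
Proof.
by rewrite (natrD _ _ e') (natrD _ (2 * z)) (natrD _ z e) (natrD _ z e') natrM; field.
Qed.

Lemma half1_rect q a n i :
  half1 (rect q a n) i = rect q (hlev a (odd i)) (hidx n (odd i) (1 < i)%N).
Proof.
have e4 (z : nat) (w : R) : (z%:R * w + z%:R * w) / 2 = z%:R * w by field.
have gc z e := (grid_child z e false, grid_child z e true).
apply: cell_eq => k o; rewrite !ffunE.
elim/ord4_ind: i; elim/ord4_ind: k; case: o;
  rewrite /rect /midpt /hlev /hidx /sel ?ffunE /= ?half_pow2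
    ?(gc _ false) ?(gc _ true) ?e4 //; by congr (_ / _); rewrite addrC.
Qed.

Lemma half2_rect q a n i :
  half2 (rect q a n) i = rect q (hlev a (odd i)) (hidx n (odd i) (i < 2)%N).
Proof.
have e4 (z : nat) (w : R) : (z%:R * w + z%:R * w) / 2 = z%:R * w by field.
have gc z e := (grid_child z e false, grid_child z e true).
apply: cell_eq => k o; rewrite !ffunE.
elim/ord4_ind: i; elim/ord4_ind: k; case: o;
  rewrite /rect /midpt /hlev /hidx /sel ?ffunE /= ?half_pow2
    ?(gc _ false) ?(gc _ true) ?e4 //; by congr (_ / _); rewrite addrC.
Qed.

Lemma quarter_rect q j n i : quarter (rect q (fun=> j) n) i =
  rect q (fun=> j.+1) (fun o => 2 * n o + cbit o i)%N.
Proof.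
apply: cell_eq => k o; rewrite !ffunE.
by case: o; rewrite /midpt /rect ?ffunE /= half_pow2 grid_child.
Qed.

Lemma cell0_rect q : cell0 q = rect q (fun=> 0%N) (fun=> 0%N).
Proof.
apply: cell_eq => i o; rewrite !ffunE co_corner.
by case: o; rewrite /= expr0 divr1.
Qed.

Definition bits_ord (e0 e1 : bool) : 'I_4 :=
  inord (if e1 then if e0 then 2 else 3 else if e0 then 1 else 0).

Lemma cbit_bits_ord e0 e1 o : cbit o (bits_ord e0 e1) = if o then e1 else e0.
Proof.
have h : ((if e1 then if e0 then 2 else 3 else if e0 then 1 else 0) < 4)%N.
  by case: (e0) (e1) => [] [].
by rewrite /cbit /bits_ord inordK //; case: o e0 e1 {h} => [] [] [].
Qed.

Lemma uniform_meshP j c : c \in uniform_mesh M0 j <->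
  exists q n, (forall o, n o < 2 ^ j)%N /\ c = rect q (fun=> j) n.
Proof.
elim: j c => [|j IH] c /=.
  split=> [/imfsetP[q _ ->]|[q [n [hn ->]]]].
    by exists q, (fun=> 0%N); split=> //; exact: cell0_rect.
  apply/imfsetP; exists q => //; rewrite cell0_rect; apply: rect_ext => // o.
  by have := hn o; rewrite expn0; lia.
split=> [/imfset2P[c' /IH[q [n [hn ->]]] [i _ ->]]|[q [n [hn ->]]]].
  exists q, (fun o => 2 * n o + cbit o i)%N; split; last exact: quarter_rect.
  by move=> o; have := hn o; rewrite expnS; case: (cbit o i); lia.
apply/imfset2P; exists (rect q (fun=> j) (fun o => (n o)./2)).
  by apply/IH; exists q, (fun o => (n o)./2); split=> // o; have := hn o; rewrite expnS; lia.
exists (bits_ord (odd (n false)) (odd (n true))) => //.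
rewrite quarter_rect; apply: rect_ext => // o.
by rewrite cbit_bits_ord; case: o; lia.
Qed.

Lemma vertex_rect q j n i :
  vertex (rect q (fun=> j) n) i = chart q (gridpt R j (fun o => n o + cbit o i)%N).
Proof. by rewrite /vertex; congr chart; apply: co_inj => o; rewrite co_rect co_gridpt. Qed.

Lemma is_vertex_rect q j n k : (forall o, n o <= k o <= (n o).+1)%N ->
  is_vertex (chart q (gridpt R j k)) (rect q (fun=> j) n).
Proof.
move=> h; exists (bits_ord (k false != n false) (k true != n true)).
rewrite vertex_rect; congr chart; apply: co_inj => o; rewrite !co_gridpt.
congr (_%:R / _); rewrite cbit_bits_ord.
by have := h o; case: o; lia.
Qed.

Lemma uniform_box j c : c \in uniform_mesh M0 j ->
  exists b : box M0, forall X, is_vertex X c -> inbox j b X.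
Proof.
move=> /uniform_meshP[q [n [hn ->]]]; exists (q, n false, n true).
move=> X [i ->]; split=> [[]|]; [exact: hn|exact: hn|]; rewrite vertex_rect; eexists; first by [].
by case; rewrite scale_gridpt !ler_nat leq_addr -[X in (_ <= X)%N]addn1 leq_add2l leq_b1.
Qed.

Lemma linked_links j A B m : linked M0 j A B m -> links M0 j m A B.
Proof.
case: m => [[]//|m] [_ [c [hc hA hB hl]]].
elim: m c A hc hA hB hl => [|m IH] c A hc hA hB hl.
  have [b hb] := uniform_box (hc 0%N isT).
  by exists B => //; exists b; apply: hb.
have [b hb] := uniform_box (hc 0%N isT).
have [X [h0 h1]] := hl 0%N isT.
exists X; first by exists b; apply: hb.
refine (IH (fun t => c t.+1) X _ h1 hB _) => t ht; [exact: hc|exact: hl].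
Qed.

(** The factor 2 makes up for the infimum, which is not known to be attained. *)
Lemma mesh_dist_close r A B : 0 < r -> (mesh_dist M0 A B <= r%:E)%E ->
  close M0 (2 * r) A B.
Proof.
move=> r0 h; have : (mesh_dist M0 A B < (2 * r)%:E)%E.
  by apply: le_lt_trans h _; rewrite lte_fin; lra.
move=> /ereal_inf_lt[_ [j _ <-]]; rewrite /dist_at; case: asboolP => [-> _|_ h2].
  by apply: close_refl; lra.
have : (ereal_inf [set m%:R%:E | m in linked M0 j A B] < (2 * r * 2 ^+ j)%:E)%E.
  have p0 := pow2_gt0 R j.
  by move: h2; rewrite muleC -lte_pdivlMr ?invr_gt0 // invrK EFinM.
move=> /ereal_inf_lt[_ [m /linked_links hm <-]]; rewrite lte_fin => h3.
by exists j, m; split=> //; exact: ltW.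
Qed.

Lemma mesh_dist_le j A B m : uniform_node M0 j A -> uniform_node M0 j B ->
  linked M0 j A B m -> (mesh_dist M0 A B <= (m%:R / 2 ^+ j)%:E)%E.
Proof.
move=> hA hB h; apply: (@le_trans _ _ ((2 ^- j)%:E * dist_at M0 j A B)%E).
  by apply: ereal_inf_lbound; exists j.
rewrite mulrC EFinM lee_pmul2l ?lte_fin ?invr_gt0 ?pow2_gt0 //.
rewrite /dist_at; case: asboolP => _; first by rewrite lee_fin.
by apply: ereal_inf_lbound; exists m.
Qed.

End Rectangles.

(** * Elements *)

Section Cells.
Variables (R : realType) (d : nat) (M0 : quad_mesh R d).
Variable di : set 'rV[R]_d -> nat.
Hypothesis diP : direction_labeling M0 di.
Implicit Types (q : elt M0) (u v : R * R) (x y r : R) (X Y A B : 'rV[R]_d) (o e : bool).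
Implicit Types (a n k : bool -> nat) (i : 'I_4) (j m : nat) (c : cell M0).
Implicit Types (F G V E : edge R d).

Notation dirq := (dirq di).
Notation dyadic := (dyadic M0 di).
Notation emid := (emid M0).

Definition inside a n : Prop := forall o, (n o < 2 ^ a o)%N.

(** Elements are squares, or squares halved once along the axis with the
    smaller direction index, because edges of that axis are subdivided first. *)
Definition shaped q a : Prop := forall o, (dirq q o < dirq q (~~ o))%N ->
  (a (~~ o) <= a o <= (a (~~ o)).+1)%N.

Definition dyadic_cell c : Prop := exists q a n,
  [/\ inside a n, shaped q a & c = rect q a n].

(** Corners 0 and 2 have the smallest and the largest coordinates. *)
Definition opencell c : set 'rV[R]_d :=
  [set X | exists2 u, X = chart c.1 u &
     forall o, co o (c.2 ord0) < co o u < co o (c.2 (ord0 + 2))].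

Lemma opencellP q a n X : opencell (rect q a n) X <->
  exists2 u, X = chart q u & forall o, (n o)%:R < 2 ^+ a o * co o u < (n o).+1%:R.
Proof.
have E u o : (co o ((rect q a n).2 ord0) < co o u < co o ((rect q a n).2 (ord0 + 2))) =
    ((n o)%:R < 2 ^+ a o * co o u < (n o).+1%:R).
  rewrite !co_rect.
  have -> : cbit o ord0 = false by case: o.
  have -> : cbit o (ord0 + 2) = true by case: o.
  by rewrite ltr_pdivrMr ?ltr_pdivlMr ?pow2_gt0 // addn0 addn1 mulrC.
by split=> -[u -> h]; exists u => // o; have := h o; rewrite E.
Qed.

Lemma inside_square a n u : inside a n ->
  (forall o, (n o)%:R < 2 ^+ a o * co o u < (n o).+1%:R) -> closed_square R u.
Proof.
move=> hn hu; apply/squareP => o; have := hu o; have /(le_natR R) := hn o.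
rewrite natr_pow2 => h1 h2; have := ler0n R (n o); have := pow2_gt0 R (a o).
by move=> p0 n0; apply/andP; split; nra.
Qed.

Lemma cb_bounds a n i o : inside a n ->
  0 <= ((n o + cbit o i)%N%:R / 2 ^+ a o : R) <= 1.
Proof. by move=> h; apply: grid_bounds; have := h o; case: (cbit o i); lia. Qed.

Lemma side_edge F q a n i : dyadic F -> inside a n -> pts F = side (rect q a n) i ->
  [/\ level F = a (odd i), dir F = dirq q (odd i) &
    emid F = chart q (pt (odd i) ((2 * n (odd i) + 1)%N%:R / 2 ^+ (a (odd i)).+1)
       ((n (~~ odd i) + cbit (~~ odd i) i)%N%:R / 2 ^+ a (~~ odd i)))].
Proof.
move=> [q' [ o' [n' [m [hn' hm EF]]]]] hn hF.
have cb := cb_bounds i (~~ odd i) hn.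
have em : emid F = mid M0 (side (rect q a n) i) by rewrite -hF.
rewrite em; move: hF; rewrite side_rect EF /= => hF.
have [] := seg_eq diP _ _ _ _ hF => //; first exact: grid_bounds.
by move=> -> -> _; split=> //; rewrite seg_mid_chart.
Qed.

Lemma pt_sel o j (x y : nat) :
  pt o (x%:R / 2 ^+ j) (y%:R / 2 ^+ j) = gridpt R j (sel o x y).
Proof. by rewrite -(pt_gridpt R o) sel1 selN. Qed.

Lemma sel_between o (x y x' y' : nat) :
  (x <= x' <= x.+1)%N -> (y <= y' <= y.+1)%N ->
  forall o', (sel o x y o' <= sel o x' y' o' <= (sel o x y o').+1)%N.
Proof. by rewrite /sel; case: o => hx hy [] /=. Qed.

(** If the side V adjacent to F is as long as F, then both midpoints are vertices
    of one box of the next level; if it is twice as long, two such boxes are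
    needed. Either way V is within one length of F. *)
Lemma dist_adjacent F V q a n i i' : dyadic F -> dyadic V -> inside a n ->
  pts F = side (rect q a n) i -> pts V = side (rect q a n) i' ->
  odd i' = ~~ odd i -> (a (~~ odd i) <= a (odd i) <= (a (~~ odd i)).+1)%N ->
  (mesh_dist M0 (emid F) (emid V) <= (2 ^- level F)%:E)%E.
Proof.
move=> dF dV hn hF hV ii ha.
have [lF _ mF] := side_edge dF hn hF; have [_ _ mV] := side_edge dV hn hV.
rewrite lF mF mV ii negbK {lF mF mV}; set o := odd i.
have h1 := hn o; have h2 := hn (~~ o); move: ha h1 h2; rewrite -/o.
move: (cbit (~~ o) i) (cbit o i') (n o) (n (~~ o)) (a o) (a (~~ o)).
clear a n hn ii dF dV hF hV => cF cV N N' l l' ll' h1 h2.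
have swap x y : pt (~~ o) x y = pt o y x by case: (o).
rewrite swap (grid_split R l).
have nodes (m : nat -> bool -> nat) t k k' : (0 < t)%N ->
    (forall s, (s < t)%N -> forall o, m s o < 2 ^ l.+1)%N ->
    (forall o, m 0%N o <= k o <= (m 0%N o).+1)%N ->
    (forall o, m t.-1 o <= k' o <= (m t.-1 o).+1)%N ->
    (forall s, (s.+1 < t)%N -> exists z : bool -> nat, forall o,
       (m s o <= z o <= (m s o).+1)%N /\ (m s.+1 o <= z o <= (m s.+1 o).+1)%N) ->
    (mesh_dist M0 (chart q (gridpt R l.+1 k)) (chart q (gridpt R l.+1 k')) <=
      (t%:R / 2 ^+ l.+1)%:E)%E.
  move=> t0 hm hk hk' hz.
  have hU s : (s < t)%N -> rect q (fun=> l.+1) (m s) \in uniform_mesh M0 l.+1.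
    by move=> hs; apply/uniform_meshP; exists q, (m s); split=> //; exact: hm.
  apply: mesh_dist_le.
  - by exists (rect q (fun=> l.+1) (m 0%N)); [exact: hU|exact: is_vertex_rect].
  - by exists (rect q (fun=> l.+1) (m t.-1)); [apply: hU; lia|exact: is_vertex_rect].
  split=> //; exists (fun s => rect q (fun=> l.+1) (m s)); split=> //.
  - exact: is_vertex_rect.
  - exact: is_vertex_rect.
  - move=> s /hz[z zP]; exists (chart q (gridpt R l.+1 z)).
    by split; apply: is_vertex_rect => o'; have [] := zP o'.
have [el|el] : l' = l \/ l = l'.+1 by lia.
  subst l'; rewrite (grid_split R l) !pt_sel.
  apply: le_trans (nodes (fun=> sel o (2 * N + cV)%N (2 * N' + cF)%N) 1%N _ _ _ _ _ _ _) _.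
  - by [].
  - by move=> s _; apply: (sel_forall (P := fun _ z => z < 2 ^ l.+1)%N);
      rewrite expnS; case: (cF) (cV) => [] []; lia.
  - by apply: sel_between; case: (cF) (cV) => [] []; lia.
  - by apply: sel_between; case: (cF) (cV) => [] []; lia.
  - by [].
  - by rewrite lee_fin mul1r exprS invfM ler_piMl ?invr_ge0 ?ltW ?pow2_gt0 //; lra.
subst l; rewrite (grid_split R l') (grid_split R l'.+1 (2 * (N' + _))).
rewrite (grid_split R l'.+1 (2 * N' + 1)).
rewrite !pt_sel.
(* The two boxes lead from the end cF of V, where F lies, to the middle of V. *)
pose m (s : nat) := sel o (2 * N + cV)%N
   (if s is 0 then 4 * N' + 3 * cF else 4 * N' + 1 + cF)%N.
apply: le_trans (nodes m 2%N _ _ _ _ _ _ _) _.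
- by [].
- by case=> [|s] _; apply: (sel_forall (P := fun _ z => z < 2 ^ l'.+2)%N);
    rewrite !expnS; move: h1; rewrite expnS;
    case: (cF) (cV) => [] []; lia.
- by apply: sel_between; case: (cF) (cV) => [] []; lia.
- by apply: sel_between; case: (cF) (cV) => [] []; lia.
- case=> [|//] _; exists (sel o (2 * N + cV)%N (4 * N' + 1 + 2 * cF)%N) => o'.
  by rewrite /m; split; apply: sel_between;
    case: (cF) (cV) => [] []; lia.
- by rewrite lee_fin exprS invfM mulrA divff // mul1r.
Qed.

End Cells.

(** * Cutting an element *)

Section CellCuts.
Variables (R : realType) (d : nat) (M0 : quad_mesh R d).
Variable di : set 'rV[R]_d -> nat.
Hypothesis diP : direction_labeling M0 di.
Implicit Types (q : elt M0) (u v : R * R) (x y r : R) (X Y A B : 'rV[R]_d) (o e : bool).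
Implicit Types (a n k : bool -> nat) (i : 'I_4) (j m : nat) (c : cell M0).
Implicit Types (F G V E : edge R d).

Lemma cut_opencell q a n i X : cut (rect q a n) i X -> opencell (rect q a n) X.
Proof.
rewrite cut_rect => /segP[x hx ->]; apply/opencellP; eexists; first by [].
set o := odd i in hx *.
suff h : (n o)%:R < 2 ^+ a o * ((2 * n o + 1)%N%:R / 2 ^+ (a o).+1 : R) < (n o).+1%:R.
  move=> o'; have [->|->] := axis_cases o o'.
    by have := co_ptN (~~ o) x ((2 * n o + 1)%N%:R / 2 ^+ (a o).+1); rewrite negbK => ->.
  by rewrite co_pt.
have -> : 2 ^+ a o * ((2 * n o + 1)%N%:R / 2 ^+ (a o).+1) = (n o)%:R + 1 / 2 :> R.
  by rewrite exprS natrD natrM; field; rewrite pow2_neq0.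
by rewrite -[(n o).+1%:R]natr1; lra.
Qed.

Lemma half_opencell q a n o e X : opencell (rect q (hlev a o) (hidx n o e)) X ->
  opencell (rect q a n) X.
Proof.
move=> /opencellP[u -> hu]; apply/opencellP; exists u => // o'.
have [->|->] := axis_cases o o'.
  have := hu o; rewrite /hlev /hidx !sel1 exprS -!natr1 natrD natrM.
  by case: e {hu} => /=; lra.
by have := hu (~~ o); rewrite /hlev /hidx !selN.
Qed.

Lemma half_inside a n o e : inside a n -> inside (hlev a o) (hidx n o e).
Proof.
move=> h o'; have [->|->] := axis_cases o o'.
  by rewrite /hlev /hidx !sel1 expnS; have := h o; case: e; lia.
by rewrite /hlev /hidx !selN.
Qed.

Lemma halves_disjoint q a n o e e' X : inside a n ->
  opencell (rect q (hlev a o) (hidx n o e)) X ->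
  opencell (rect q (hlev a o) (hidx n o e')) X -> e = e'.
Proof.
move=> hn /opencellP[u -> hu] /opencellP[v euv hv].
have uv : u = v.
  apply: chart_inj euv; first exact: inside_square (half_inside _ _ hn) hu.
  exact: inside_square (half_inside _ _ hn) hv.
have := hu o; have := hv o; rewrite uv /hlev /hidx !sel1 -!natr1 !natrD.
by case: e e' {hu hv} => [] [] //=; lra.
Qed.

Lemma cut_half q a n i e X : inside a n -> cut (rect q a n) i X ->
  ~ opencell (rect q (hlev a (odd i)) (hidx n (odd i) e)) X.
Proof.
move=> hn hX /opencellP[u eX hu]; move: (hX) => /cut_opencell/opencellP[w eX' hw].
have uw : u = w.
  apply: (@chart_inj _ _ _ q); last by rewrite -eX -eX'.
    exact: inside_square (half_inside _ _ hn) hu.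
  exact: inside_square hw.
move: hX; rewrite cut_rect => /segP[x hx eX2].
set o := odd i in hx hu eX2 *.
have yE : 2 ^+ (a o).+1 * ((2 * n o + 1)%N%:R / 2 ^+ (a o).+1) = (2 * n o + 1)%N%:R :> R.
  by rewrite mulrC divfK // pow2_neq0.
have wE : w = pt (~~ o) x ((2 * n o + 1)%N%:R / 2 ^+ (a o).+1).
  apply: (@chart_inj _ _ _ q); [exact: inside_square hw| |by rewrite -eX'].
  apply: square_pt; last by apply: grid_bounds; have := hn o; rewrite expnS; lia.
  have /(le_natR R) := hn (~~ o); rewrite natr_pow2 => h1.
  have := ler0n R (n (~~ o)); have := pow2_gt0 R (a (~~ o)).
  by move=> p0 n0; apply/andP; split; nra.
have := hu o; rewrite uw wE /hlev /hidx !sel1.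
have -> : co o (pt (~~ o) x ((2 * n o + 1)%N%:R / 2 ^+ (a o).+1)) =
    (2 * n o + 1)%N%:R / 2 ^+ (a o).+1.
  by have := co_ptN (~~ o) x ((2 * n o + 1)%N%:R / 2 ^+ (a o).+1); rewrite negbK.
by rewrite yE !ltr_nat; case: e {hu}; lia.
Qed.

Lemma child_seg q o m m' e y X : seg q o m.+1 (2 * m' + e) y X -> seg q o m m' y X.
Proof.
move=> /segP[x hx ->]; apply/segP; exists x => //; move: hx.
by rewrite exprS -!natr1 natrD natrM; case: e => /=; lra.
Qed.

Lemma seg_pt_square q o m m' y x : (m' < 2 ^ m)%N -> 0 <= y <= 1 ->
  m'%:R < 2 ^+ m * x < m'.+1%:R -> closed_square R (pt o x y).
Proof.
move=> hm hy hx; apply: square_pt => //.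
have /(le_natR R) := hm; rewrite natr_pow2 => h1.
have := ler0n R m'; have := pow2_gt0 R m.
by move=> p0 n0; apply/andP; split; nra.
Qed.

Lemma children_disjoint q o m m' e e' y X : (m' < 2 ^ m)%N -> 0 <= y <= 1 ->
  seg q o m.+1 (2 * m' + e) y X -> seg q o m.+1 (2 * m' + e') y X -> e = e'.
Proof.
move=> hm hy /segP[x hx ->] /segP[x' hx' eX].
have hm2 (b : bool) : (2 * m' + b < 2 ^ m.+1)%N by rewrite expnS; case: b; lia.
have /(congr1 (co o)) : pt o x y = pt o x' y.
  apply: chart_inj eX; first exact: seg_pt_square (hm2 e) hy hx.
  exact: seg_pt_square (hm2 e') hy hx'.
rewrite !co_pt => ex; subst x'; move: hx hx'; rewrite -!natr1 !natrD.
by case: e e' {eX} => [] [] //=; lra.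
Qed.

Lemma mid_seg q o m m' y : (m' < 2 ^ m)%N -> 0 <= y <= 1 ->
  seg q o m m' y (mid M0 (seg q o m m' y)).
Proof.
move=> hm hy; rewrite seg_mid_chart //; apply/segP; eexists; last by [].
have -> : 2 ^+ m * ((2 * m' + 1)%N%:R / 2 ^+ m.+1) = m'%:R + 1 / 2 :> R.
  by rewrite exprS natrD natrM; field; rewrite pow2_neq0.
by rewrite -[m'.+1%:R]natr1; lra.
Qed.

Lemma mid_not_child q o m m' e y : (m' < 2 ^ m)%N -> 0 <= y <= 1 ->
  ~ seg q o m.+1 (2 * m' + e) y (mid M0 (seg q o m m' y)).
Proof.
move=> hm hy; rewrite seg_mid_chart // => /segP[x hx eX].
have hm2 (b : bool) : (2 * m' + b < 2 ^ m.+1)%N by rewrite expnS; case: b; lia.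
have /(congr1 (co o)) : pt o ((2 * m' + 1)%N%:R / 2 ^+ m.+1) y = pt o x y.
  apply: chart_inj eX; last exact: seg_pt_square (hm2 e) hy hx.
  by apply: square_pt => //; apply: grid_bounds; have := hm2 true; lia.
rewrite !co_pt => ex; move: hx; rewrite -ex mulrC divfK ?pow2_neq0 // !ltr_nat.
by case: e; lia.
Qed.

Lemma seg_children q o m (k : nat) y q' o' m' (k' : nat) y' e' :
  (k < 2 ^ m)%N -> 0 <= y <= 1 -> (k' < 2 ^ m')%N -> 0 <= y' <= 1 ->
  seg q o m k y = seg q' o' m' k' y' ->
  exists e, seg q' o' m'.+1 (2 * k' + e') y' = seg q o m.+1 (2 * k + e) y.
Proof.
move=> hk hy hk' hy' E.
have [h1 h2] := seg_square q o hk hy; have [h3 h4] := seg_square q' o' hk' hy'.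
have [_] := arc_halves h1 h2 h3 h4 (@seg_neq _ o m k y) (seg_axis o m k y) E.
have [-> ->] := seg_halves q o m k y; have [-> ->] := seg_halves q' o' m' k' y'.
by case=> -[e1 e2]; case: e'; [exists true|exists false|exists false|exists true];
  rewrite /= ?addn0.
Qed.

Lemma ord4_opp i i' : odd i' = odd i -> i' = i \/ i' = i + 2.
Proof.
by elim/ord4_ind: i; elim/ord4_ind: i' => //= _; [left|right|left|right|right|left|right|left];
  apply/val_inj.
Qed.

Lemma cbit_opp i o : o != odd i -> cbit o (i + 2) = ~~ cbit o i.
Proof. by elim/ord4_ind: i; case: o. Qed.

Lemma odd_add1 i : odd (i + 1)%R = ~~ odd i.
Proof. by elim/ord4_ind: i. Qed.
Lemma odd_add2 i : odd (i + 2)%R = odd i.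
Proof. by elim/ord4_ind: i. Qed.
Lemma odd_add3 i : odd (i + 3)%R = ~~ odd i.
Proof. by elim/ord4_ind: i. Qed.

Lemma side_inj q a n i i' : inside a n ->
  side (rect q a n) i = side (rect q a n) i' -> i = i'.
Proof.
have cb := cb_bounds R; move=> hn; rewrite !side_rect.
move=> /(seg_eq diP (hn _) (cb _ _ _ _ hn) (hn _) (cb _ _ _ _ hn)).
case=> _ _ /(_ erefl)[ei +]; rewrite -ei => /(congr1 (fun x => x * 2 ^+ a (~~ odd i))).
rewrite !divfK ?pow2_neq0 // => /eqP; rewrite eqr_nat eqn_add2l => /eqP cc.
case: (ord4_opp (esym ei)) => [-> //|e]; move: cc; rewrite e cbit_opp; last by case: (odd i).
by case: cbit.
Qed.

End CellCuts.

(** * Admissible subdivisions *)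

Section Steps.
Variables (R : realType) (d : nat) (M0 : quad_mesh R d).
Variable di : set 'rV[R]_d -> nat.
Hypothesis diP : direction_labeling M0 di.
Implicit Types (q : elt M0) (u v : R * R) (x y r : R) (X Y A B : 'rV[R]_d) (o e : bool).
Implicit Types (a n : bool -> nat) (i : 'I_4) (c : cell M0).
Implicit Types (F G V E : edge R d) (M : tmesh M0).

Notation dirq := (dirq di).
Notation dyadic := (dyadic M0 di).
Notation emid := (emid M0).
Notation dyadic_cell := (dyadic_cell di).
Notation shaped := (shaped di).

(** The disjointness conditions serve to show that no edge is subdivided twice.
    By sides_edges, an element has been cut as soon as two opposite sides are
    both subdivided; hence the cut of an element always finds an edge parallel
    to it, from which it inherits level and direction index. *)
Record valid M : Prop := Valid {
  edges_dyadic : forall F, F \in edges M -> dyadic F;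
  cells_dyadic : forall c, c \in elements M -> dyadic_cell c;
  edges_disjoint : forall F G X, F \in edges M -> G \in edges M ->
    pts F X -> pts G X -> F = G;
  cells_disjoint : forall c c' X, c \in elements M -> c' \in elements M ->
    opencell c X -> opencell c' X -> c = c';
  edges_cells : forall F c X, F \in edges M -> c \in elements M ->
    pts F X -> ~ opencell c X;
  nodes_edges : forall F X, F \in edges M -> X \in nodes M -> ~ pts F X;
  nodes_cells : forall c X, c \in elements M -> X \in nodes M -> ~ opencell c X;
  sides_edges : forall c i, c \in elements M -> exists2 F, F \in edges M &
    pts F = side c i \/ pts F = side c (i + 2)
}.

Lemma splitsP M E c i : (c, i) \in splits M E <->
  [/\ c \in elements M, side c i = pts E &
    ~ exists2 F, F \in edges M & pts F = side c (i + 2)].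
Proof.
rewrite /splits !inE /=; split.
  by move=> /andP[/andP[h _] /asboolP[h1 h2]].
case=> h h1 h2; apply/andP; split; last exact/asboolP.
by rewrite h.
Qed.

Lemma emid_pts F : dyadic F -> pts F (emid F).
Proof.
case=> q [ o [n [m [hn hm ->]]]]; apply: mid_seg => //; exact: grid_bounds.
Qed.

Section Step.
Variables (p : nat) (M M' : tmesh M0) (E : edge R d).
Hypotheses (p_gt0 : (0 < p)%N) (MV : valid M) (EM : E \in edges M).
Hypotheses (Eobs : obstructing p M E = fset0) (EM' : subdiv M E M').

Lemma not_obstructing V : V \in edges M ->
  (edge_dist M0 E V <= (2 ^- level E)%:E)%E ->
  ~~ ((level V < level E)%N || (level V == level E) && (dir V < dir E)%N).
Proof.
move=> hV hd; apply/negP => h.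
have : V \in obstructing p M E.
  rewrite /obstructing !inE /= h andbT; apply/andP; split => //.
  apply/asboolP; apply: le_trans hd _; rewrite lee_fin ler_peMl ?invr_ge0 ?exprn_ge0 //.
  by have := le_natR R p_gt0; rewrite -[p.+1%:R]natr1; lra.
by rewrite Eobs inE.
Qed.

(** By dist_adjacent an edge V adjacent to E is a neighbor of E unless it is
    shorter. Since it does not obstruct E, it is not longer, and if equally long,
    has a larger direction index. So both halves are shaped again. *)
Lemma split_cell c i : (c, i) \in splits M E -> exists q a n,
  [/\ c = rect q a n, inside a n, level E = a (odd i), dir E = dirq q (odd i) &
   [/\ (a (odd i) <= a (~~ odd i) <= (a (odd i)).+1)%N, shaped q (hlev a (odd i)) &
   forall V, V \in edges M -> pts V = side c (i + 1) \/ pts V = side c (i + 3) ->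
     level V = a (~~ odd i) /\ dir V = dirq q (~~ odd i)]].
Proof.
case/splitsP => hc hi _; have [q [a [n [hn hs cE]]]] := cells_dyadic MV hc.
have dE := edges_dyadic MV EM.
rewrite cE in hi *; have [lE dirE mE] := side_edge diP dE hn (esym hi).
exists q, a, n; split=> //.
have adj V : V \in edges M -> pts V = side c (i + 1) \/ pts V = side c (i + 3) ->
    [/\ level V = a (~~ odd i), dir V = dirq q (~~ odd i) & exists i',
       pts V = side (rect q a n) i' /\ odd i' = ~~ odd i].
  move=> hV; rewrite cE => -[] h;
    have [-> -> _] := side_edge diP (edges_dyadic MV hV) hn h.
    by rewrite odd_add1; split=> //; exists (i + 1); rewrite odd_add1.
  by rewrite odd_add3; split=> //; exists (i + 3); rewrite odd_add3.
have [V hV sV] : exists2 V, V \in edges M & pts V = side c (i + 1) \/ pts V = side c (i + 3).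
  have [V hV sV] := sides_edges MV (i + 1) hc; exists V => //.
  by move: sV; rewrite -addrA; congr (_ \/ pts V = side c (i + _)); exact/val_inj.
have [lV dirV [i' [si' oi']]] := adj V hV sV.
have dV := edges_dyadic MV hV.
have dneq : dirq q (odd i) != dirq q (~~ odd i) by exact: dirq_neq.
have ho := hs (odd i); have hNo := hs (~~ odd i); rewrite negbK in hNo.
have no : (a (~~ odd i) <= a (odd i) <= (a (~~ odd i)).+1)%N ->
    ~~ ((level V < level E)%N || (level V == level E) && (dir V < dir E)%N).
  move=> h; apply: not_obstructing => //.
  exact: (dist_adjacent diP dE dV hn (esym hi) si' oi' h).
rewrite lE dirE lV dirV in no.
move: ho hNo no dneq; set D := dirq q (odd i); set D' := dirq q (~~ odd i).
set l := a (odd i); set l' := a (~~ odd i) => ho hNo no dneq.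
have key : (l <= l' <= l.+1)%N /\ (l = l' -> (D < D')%N).
  have : (D < D' \/ D' < D)%N by lia.
  by case=> h; [have := ho h|have := hNo h]; move: no; lia.
split; first exact: key.1.
  move=> o'; have [->|->] := axis_cases (odd i) o'.
    rewrite /hlev sel1 selN -/D -/D' -/l -/l' => h; have := ho h; have := key.1; lia.
  rewrite negbK /hlev sel1 selN -/D -/D' -/l -/l' => h.
  have := key; lia.
by move=> W hW; rewrite -cE => sW; have [] := adj W hW sW.
Qed.

Let E_dyadic := edges_dyadic MV EM.

Definition child_edge q o (n : nat) y e : edge R d :=
  Edge (seg q o (level E).+1 (2 * n + e) y) (level E).+1 (dir E).

Lemma subdiv_edges : exists q o (n m : nat),
  [/\ (n < 2 ^ level E)%N, (m <= 2 ^ (level E).+1)%N, E = dyedge di q o (level E) n m &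
   forall F, F \in edges M' <-> [\/ F != E /\ F \in edges M,
     exists e, F = child_edge q o n (m%:R / 2 ^+ (level E).+1) e | F \in cut_edges M E]].
Proof.
have [q [ o [n [m [hn hm EE]]]]] := E_dyadic; exists q, o, n, m; split=> // F.
case: EM' => q' [u [v [hu hv Euv /= ->]]] /=.
have hy : 0 <= (m%:R / 2 ^+ (level E).+1 : R) <= 1 by exact: grid_bounds.
have [h1 h2] := seg_square q o hn hy.
have E2 : arc q (pt o (n%:R / 2 ^+ level E) (m%:R / 2 ^+ (level E).+1))
   (pt o (n.+1%:R / 2 ^+ level E) (m%:R / 2 ^+ (level E).+1)) = arc q' u v.
  by rewrite -Euv (congr1 (@pts R d) EE).
have [_] := arc_halves h1 h2 hu hv (@seg_neq _ o _ _ _) (seg_axis o _ _ _) E2.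
have [-> ->] := seg_halves q o (level E) n (m%:R / 2 ^+ (level E).+1).
move=> hh; rewrite !inE.
have ch0 : Edge (seg q o (level E).+1 (2 * n) (m%:R / 2 ^+ (level E).+1)) (level E).+1 (dir E)
   = child_edge q o n (m%:R / 2 ^+ (level E).+1) false.
  by rewrite /child_edge addn0.
case: hh => -[<- <-]; rewrite ch0; split.
- case/orP; last by constructor 3.
  case/orP => [/andP[h h']|]; first by constructor 1.
  by case/orP => /eqP ->; constructor 2; [exists false|exists true].
- case=> [[h h']|[e ->]|->]; rewrite ?orbT //; first by rewrite h h'.
  by case: e; rewrite eqxx ?orbT.
- case/orP; last by constructor 3.
  case/orP => [/andP[h h']|]; first by constructor 1.
  by case/orP => /eqP ->; constructor 2; [exists true|exists false].
- case=> [[h h']|[e ->]|->]; rewrite ?orbT //; first by rewrite h h'.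
  by case: e; rewrite eqxx ?orbT.
Qed.

Lemma subdiv_elements c : c \in elements M' <->
  (c \in elements M /\ forall i, (c, i) \notin splits M E) \/
  exists q a n i e, [/\ (rect q a n, i) \in splits M E, inside a n,
    shaped q (hlev a (odd i)) & c = rect q (hlev a (odd i)) (hidx n (odd i) e)].
Proof.
case: EM' => q' [u [v [hu hv Euv /= ->]]] /=; rewrite !inE; split.
  case/orP => [/orP[/andP[h1 h2]|]|].
  - left; split=> // i; apply/negP => h; move: h1; apply/negP; rewrite negbK.
    by apply/imfsetP; exists (c, i).
  - case/imfsetP => -[c' i] /= hs ->; right; have [q [a [n [cE hn _ _ [_ sh _]]]]] := split_cell hs.
    by exists q, a, n, i, (1 < i)%N; rewrite -cE; split=> //; rewrite cE half1_rect.
  - case/imfsetP => -[c' i] /= hs ->; right; have [q [a [n [cE hn _ _ [_ sh _]]]]] := split_cell hs.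
    by exists q, a, n, i, (i < 2)%N; rewrite -cE; split=> //; rewrite cE half2_rect.
case=> [[h1 h2]|[q [a [n [i [e [hs hn sh ->]]]]]]].
  apply/orP; left; apply/orP; left; rewrite h1 andbT.
  by apply/negP => /imfsetP[[c' i] /= hs ec]; have := h2 i; rewrite ec hs.
have [ei|ei] : e = (1 < i)%N \/ e = (i < 2)%N by case: e; elim/ord4_ind: i {hs sh}; auto.
  apply/orP; left; apply/orP; right; apply/imfsetP; exists (rect q a n, i) => //=.
  by rewrite half1_rect ei.
apply/orP; right; apply/imfsetP; exists (rect q a n, i) => //=.
by rewrite half2_rect ei.
Qed.

Lemma subdiv_nodes X : X \in nodes M' <-> X = emid E \/ X \in nodes M.
Proof.
case: EM' => q' [u [v [hu hv Euv /= ->]]] /=; rewrite !inE.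
by split=> [/orP[/eqP|]|[->|->]]; rewrite ?eqxx ?orbT; auto.
Qed.

Lemma cut_edgesP F : F \in cut_edges M E <-> exists q a n i,
  [/\ (rect q a n, i) \in splits M E, inside a n &
   [/\ level E = a (odd i), dir E = dirq q (odd i),
     (a (odd i) <= a (~~ odd i) <= (a (odd i)).+1)%N, shaped q (hlev a (odd i)) &
    F = Edge (cut (rect q a n) i) (a (~~ odd i)) (dirq q (~~ odd i))]].
Proof.
split.
  case/imfsetP => -[[c i] V] /=; rewrite inE /= => /andP[]; rewrite inE /= => /andP[hs hV].
  move=> /asboolP sV ->; have [q [a [n [cE hn lE dE [h sh adj]]]]] := split_cell hs.
  have [-> ->] := adj V hV sV; rewrite cE.
  by exists q, a, n, i; rewrite -cE.
case=> q [a [n [i [hs hn [lE dE h sh ->]]]]].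
have hc : rect q a n \in elements M by case/splitsP: hs.
have [V hV sV] := sides_edges MV (i + 1) hc.
have sV' : pts V = side (rect q a n) (i + 1) \/ pts V = side (rect q a n) (i + 3).
  by move: sV; rewrite -addrA; congr (_ \/ pts V = side _ (i + _)); exact/val_inj.
have [lV dV] : level V = a (~~ odd i) /\ dir V = dirq q (~~ odd i).
  by case: sV' => sV'; have [-> -> _] := side_edge diP (edges_dyadic MV hV) hn sV';
    rewrite ?odd_add1 ?odd_add3.
apply/imfsetP; exists ((rect q a n, i), V); last by rewrite lV dV.
by rewrite inE /= inE /= hs hV; apply/asboolP.
Qed.

End Step.
End Steps.

(** * Conservation of the mesh structure *)

Section StepValid.
Variables (R : realType) (d : nat) (M0 : quad_mesh R d).
Variable di : set 'rV[R]_d -> nat.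
Hypothesis diP : direction_labeling M0 di.
Implicit Types (q : elt M0) (u v : R * R) (x y r : R) (X Y A B : 'rV[R]_d) (o e : bool).
Implicit Types (a n : bool -> nat) (i : 'I_4) (c : cell M0).
Implicit Types (F G V : edge R d).

Notation dirq := (dirq di).
Notation dyadic := (dyadic M0 di).
Notation emid := (emid M0).
Notation valid := (valid di).
Notation shaped := (shaped di).

Variables (p : nat) (M M' : tmesh M0) (E : edge R d).
Hypotheses (p_gt0 : (0 < p)%N) (MV : valid M) (EM : E \in edges M).
Hypotheses (Eobs : obstructing p M E = fset0) (EM' : subdiv M E M').

Let ME := subdiv_edges MV EM EM'.
Let Mc := subdiv_elements diP p_gt0 MV EM Eobs EM'.
Let Mn := subdiv_nodes EM'.
Let cutP := cut_edgesP diP p_gt0 MV EM Eobs.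

Inductive edge_origin F : Prop :=
| OldEdge of F != E & F \in edges M
| ChildEdge q o (k m : nat) e of (k < 2 ^ level E)%N & (m <= 2 ^ (level E).+1)%N &
    E = dyedge di q o (level E) k m & F = child_edge E q o k (m%:R / 2 ^+ (level E).+1) e
| CutEdge of F \in cut_edges M E.

Lemma edge_originP F : F \in edges M' -> edge_origin F.
Proof.
have [q [ o [k [m [hk hm EE h]]]]] := ME.
by move/h => [[h1 h2]|[e ->]|h1]; [exact: OldEdge|exact: ChildEdge EE _|exact: CutEdge].
Qed.

Lemma child_dyadic q o (k m : nat) e : (k < 2 ^ level E)%N -> (m <= 2 ^ (level E).+1)%N ->
  E = dyedge di q o (level E) k m ->
  dyadic (child_edge E q o k (m%:R / 2 ^+ (level E).+1) e).
Proof.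
move=> hk hm EE; exists q, o, (2 * k + e)%N, (2 * m)%N; split=> /=.
- by rewrite expnS; case: e; lia.
- by rewrite expnS; lia.
- by rewrite /child_edge /dyedge -grid_split (congr1 (@dir R d) EE).
Qed.

Lemma cut_dyadic F : F \in cut_edges M E -> dyadic F.
Proof.
move=> /cutP[q [a [n [i [hs hn [lE dE h sh ->]]]]]].
set o := odd i in h *.
exists q, (~~ o), (n (~~ o)), ((2 * n o + 1) * 2 ^ (a (~~ o) - a o))%N; split=> /=.
- exact: hn.
- have h1 := hn o; have e1 : (2 * n o + 1 <= 2 ^ (a o).+1)%N by rewrite expnS; lia.
  apply: leq_trans (leq_mul e1 (leqnn _)) _.
  by rewrite -expnD leq_exp2l //; lia.
- rewrite cut_rect /dyedge; congr (Edge (seg _ _ _ _ _) _ _).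
  rewrite natrM natr_pow2.
  have -> : (a (~~ o)).+1 = ((a o).+1 + (a (~~ o) - a o))%N by lia.
  by rewrite exprD; field; rewrite !pow2_neq0.
Qed.

Lemma child_sub q o (k m : nat) e X : E = dyedge di q o (level E) k m ->
  pts (child_edge E q o k (m%:R / 2 ^+ (level E).+1) e) X -> pts E X.
Proof. by move=> EE /= /child_seg; rewrite (congr1 (@pts R d) EE). Qed.

Lemma cut_old_cell F X : F \in cut_edges M E -> pts F X ->
  exists2 c, c \in elements M & opencell c X.
Proof.
move=> /cutP[q [a [n [i [hs hn [lE dE h sh ->]]]]]] /= hX.
exists (rect q a n); last exact: cut_opencell hX.
by case/splitsP: hs.
Qed.

Lemma cell_origin c X : c \in elements M' -> opencell c X ->
  exists2 c', c' \in elements M & opencell c' X.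
Proof.
move=> /Mc[[hc _]|[q [a [n [i [e [hs _ _ ->]]]]]]]; first by exists c.
move=> /half_opencell; exists (rect q a n) => //.
by case/splitsP: hs.
Qed.

Lemma cut_edges_disjoint F G X : F \in cut_edges M E -> G \in cut_edges M E ->
  pts F X -> pts G X -> F = G.
Proof.
move=> /cutP[q [a [n [i [hs hn [lE dE h sh ->]]]]]].
move=> /cutP[q' [a' [n' [i' [hs' hn' [lE' dE' h' sh' ->]]]]]] /= hX hX'.
have [hc si _] := (splitsP _ _ _ _).1 hs; have [hc' si' _] := (splitsP _ _ _ _).1 hs'.
have ec := cells_disjoint MV hc hc' (cut_opencell hX) (cut_opencell hX').
have ei : i = i' by apply: (side_inj (q := q) diP hn); rewrite si ec si'.
have [qq aa _] := rect_inj ec.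
by congr Edge; [rewrite ec ei|rewrite aa ei|rewrite qq ei].
Qed.

Lemma step_edges_disjoint F G X : F \in edges M' -> G \in edges M' ->
  pts F X -> pts G X -> F = G.
Proof.
have old_child F' G' : F' != E -> F' \in edges M -> pts F' X -> pts E X -> F' = G'.
  by move=> h1 h2 h3 h4; have := edges_disjoint MV h2 EM h3 h4; move/eqP: h1.
have old_cut F' G' : F' \in edges M -> G' \in cut_edges M E -> pts F' X -> pts G' X -> False.
  move=> h1 h2 h3 /(cut_old_cell h2)[c hc hX].
  exact: (edges_cells MV h1 hc h3 hX).
move=> /edge_originP[h1 h1'|q o k m e hk hm EE ->|h1];
move=> /edge_originP[h2 h2'|q' o' k' m' e' hk' hm' EE' ->|h2] hF hG.
- exact: (edges_disjoint MV h1' h2' hF hG).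
- exact: old_child h1 h1' hF (child_sub EE' hG).
- by case: (old_cut _ _ h1' h2 hF hG).
- exact/esym/(old_child _ _ h2 h2' hG (child_sub EE hF)).
- have hy := grid_bounds R hm; have hy' := grid_bounds R hm'.
  have Es : seg q o (level E) k (m%:R / 2 ^+ (level E).+1) =
     seg q' o' (level E) k' (m'%:R / 2 ^+ (level E).+1).
    by have := congr1 (@pts R d) EE; have := congr1 (@pts R d) EE' => /= <- <-.
  have [e2 Es2] := seg_children e' hk hy hk' hy' Es.
  move: hG; rewrite /child_edge /= Es2 => hG.
  by rewrite (children_disjoint hk hy hF hG).
- by case: (old_cut _ _ EM h2 (child_sub EE hF) hG).
- by case: (old_cut _ _ h2' h1 hG hF).
- by case: (old_cut _ _ EM h1 (child_sub EE' hG) hF).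
- exact: (cut_edges_disjoint h1 h2 hF hG).
Qed.


Lemma step_cells_disjoint c c' X : c \in elements M' -> c' \in elements M' ->
  opencell c X -> opencell c' X -> c = c'.
Proof.
move=> /Mc[[h1 h2]|[q [a [n [i [e [hs hn sh ->]]]]]]];
move=> /Mc[[h1' h2']|[q' [a' [n' [i' [e' [hs' hn' sh' ->]]]]]]] hX hX'.
- exact: (cells_disjoint MV h1 h1' hX hX').
- have [hc' _ _] := (splitsP _ _ _ _).1 hs'.
  have e1 := cells_disjoint MV h1 hc' hX (half_opencell hX').
  by have := h2 i'; rewrite e1 hs'.
- have [hc _ _] := (splitsP _ _ _ _).1 hs.
  have e1 := cells_disjoint MV h1' hc hX' (half_opencell hX).
  by have := h2' i; rewrite e1 hs.
have [hc si _] := (splitsP _ _ _ _).1 hs; have [hc' si' _] := (splitsP _ _ _ _).1 hs'.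
have ec := cells_disjoint MV hc hc' (half_opencell hX) (half_opencell hX').
have ei : i = i' by apply: (side_inj (q := q) diP hn); rewrite si ec si'.
have [qq aa nn] := rect_inj ec.
have E1 : rect q (hlev a (odd i)) (hidx n (odd i) e) =
    rect q' (hlev a' (odd i')) (hidx n' (odd i') e).
  by rewrite qq ei; apply: rect_ext => o; rewrite /hlev /hidx /sel ?aa ?nn.
by move: hX; rewrite E1 => /(halves_disjoint hn' hX') ->.
Qed.

Lemma step_edges_cells F c X : F \in edges M' -> c \in elements M' ->
  pts F X -> ~ opencell c X.
Proof.
have old G : G \in edges M -> c \in elements M' -> pts G X -> ~ opencell c X.
  by move=> hG hc hX /(cell_origin hc)[c' hc'];  exact (edges_cells MV hG hc' hX).
move=> /edge_originP[h1 h1'|q o k m e hk hm EE ->|h1] hc hX.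
- exact: old h1' hc hX.
- exact: old EM hc (child_sub EE hX).
move: h1 => /cutP[q [a [n [i [hs hn [lE dE h sh eF]]]]]] hX2.
move: hX; rewrite eF /= => hX.
have [hcc _ _] := (splitsP _ _ _ _).1 hs.
move/Mc: hc => [[h1 h2]|[q' [a' [n' [i' [e' [hs' hn' sh' ec']]]]]]].
  have ec := cells_disjoint MV hcc h1 (cut_opencell hX) hX2.
  by have := h2 i; rewrite -ec hs.
subst c; have [hcc' si' _] := (splitsP _ _ _ _).1 hs'; have [_ si _] := (splitsP _ _ _ _).1 hs.
have ec := cells_disjoint MV hcc hcc' (cut_opencell hX) (half_opencell hX2).
have ei : i = i' by apply: (side_inj (q := q) diP hn); rewrite si ec si'.
move: hX; rewrite ec ei => hX; exact: cut_half hn' hX hX2.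
Qed.

Lemma step_nodes_edges F X : F \in edges M' -> X \in nodes M' -> ~ pts F X.
Proof.
move=> /edge_originP[h1 h1'|q o k m e hk hm EE ->|h1] /Mn[->|hX] hF.
- have EE := edges_disjoint MV h1' EM hF (emid_pts (edges_dyadic MV EM)).
  by rewrite EE eqxx in h1.
- exact: (nodes_edges MV h1' hX hF).
- move: hF; rewrite /emid (congr1 (@pts R d) EE); apply: mid_not_child => //.
  exact: grid_bounds.
- exact: (nodes_edges MV EM hX (child_sub EE hF)).
- have [c hc hX] := cut_old_cell h1 hF.
  exact: (edges_cells MV EM hc (emid_pts (edges_dyadic MV EM)) hX).
- have [c hc hX2] := cut_old_cell h1 hF.
  exact: (nodes_cells MV hc hX hX2).
Qed.

Lemma step_nodes_cells c X : c \in elements M' -> X \in nodes M' -> ~ opencell c X.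
Proof.
move=> hc /Mn[->|hX] /(cell_origin hc)[c' hc'].
  exact: (edges_cells MV EM hc' (emid_pts (edges_dyadic MV EM))).
exact: (nodes_cells MV hc' hX).
Qed.

Lemma step_edge F : F \in edges M -> F != E -> F \in edges M'.
Proof.
have [q [ o [k [m [hk hm EE h]]]]] := ME.
by move=> h1 h2; apply/h; constructor 1.
Qed.

Lemma step_sides_edges c i : c \in elements M' -> exists2 F, F \in edges M' &
  pts F = side c i \/ pts F = side c (i + 2).
Proof.
have i22 j : j + 2 + 2 = j :> 'I_4 by elim/ord4_ind: j; exact/val_inj.
move=> /Mc[[hc hs]|].
  have [F hF sF] := sides_edges MV i hc.
  have [eF|nF] := eqVneq F E; last by exists F => //; exact: step_edge.
  have opp j : pts F = side c j -> exists2 G, G \in edges M' & pts G = side c (j + 2).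
    rewrite eF => sE.
    have [G hG sG] : exists2 G, G \in edges M & pts G = side c (j + 2).
      by apply: contrapT => h; have := hs j; rewrite ((splitsP _ _ _ _).2 _).
    exists G => //; apply: step_edge => //; apply/eqP => GE.
    have [q [a [n [hn _ ec]]]] := cells_dyadic MV hc.
    have /(side_inj diP hn) : side (rect q a n) j = side (rect q a n) (j + 2).
      by rewrite -ec -sG -sE GE.
    by elim/ord4_ind: j {sE sG}.
  case: sF => /opp[G hG sG]; exists G => //; [by right|left].
  by rewrite sG i22.
move=> [q [a [n [i0 [e [hs hn sh ->]]]]]].
have [hc si0 _] := (splitsP _ _ _ _).1 hs.
have [oi|oi] := axis_cases (odd i0) (odd i).
  have [F hF sF] : exists2 F, F \in edges M' &
      pts F = side (rect q (hlev a (odd i0)) (hidx n (odd i0) e)) i0.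
    have [q' [ o' [k [m [hk hm EE h]]]]] := ME.
    have := si0; rewrite (congr1 (@pts R d) EE) side_rect => Es.
    have [e' Es'] := seg_children e hk (grid_bounds R hm) (hn _) (cb_bounds R _ _ hn) (esym Es).
    exists (child_edge E q' o' k (m%:R / 2 ^+ (level E).+1) e').
      by apply/h; constructor 2; exists e'.
    by rewrite /= -Es' side_rect /hlev /hidx !sel1 !selN.
  exists F => //; rewrite sF; have [->|->] := ord4_opp (esym oi); first by left.
  by right.
have [q' [a' [n' [ec _ lE dE [h sh' _]]]]] := split_cell diP p_gt0 MV EM Eobs hs.
have [qq aa nn] := rect_inj ec; set o := odd i0 in oi *.
pose F := Edge (cut (rect q a n) i0) (a (~~ o)) (dirq q (~~ o)).
exists F.
  have [? [? [? [? [? ? ? hF]]]]] := ME; apply/hF; constructor 3; apply/cutP.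
  by exists q, a, n, i0; split=> //; split=> //; rewrite ?qq ?aa.
rewrite /F /= cut_rect !side_rect odd_add2 oi negbK -/o /hlev /hidx !sel1 !selN.
rewrite cbit_opp; last by rewrite oi; case: (o).
rewrite -!addnA; case: (e); case: (cbit o i); rewrite ?addn0; by [left|right].
Qed.

Lemma step_cells_dyadic c : c \in elements M' -> dyadic_cell di c.
Proof.
move=> /Mc[[hc _]|[q [a [n [i [e [hs hn sh ->]]]]]]]; first exact (cells_dyadic MV hc).
by exists q, (hlev a (odd i)), (hidx n (odd i) e); split=> //; exact: half_inside.
Qed.

Lemma step_edges_dyadic F : F \in edges M' -> dyadic F.
Proof.
move=> /edge_originP[h1 h1'|q o k m e hk hm EE ->|h1].
- exact (edges_dyadic MV h1').
- exact: child_dyadic EE.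
- exact: cut_dyadic.
Qed.

Lemma valid_step : valid M'.
Proof.
split.
- exact: step_edges_dyadic.
- exact: step_cells_dyadic.
- exact: step_edges_disjoint.
- exact: step_cells_disjoint.
- exact: step_edges_cells.
- exact: step_nodes_edges.
- exact: step_nodes_cells.
- exact: step_sides_edges.
Qed.

End StepValid.

(** * The initial mesh *)

Section Initial.
Variables (R : realType) (d : nat) (M0 : quad_mesh R d).
Variable di : set 'rV[R]_d -> nat.
Hypothesis diP : direction_labeling M0 di.
Implicit Types (q : elt M0) (u v : R * R) (s t : R) (X : 'rV[R]_d) (a b i j : 'I_4).

Lemma bit_open (e : bool) t : 0 < t < 1 -> t <> e%:R.
Proof. by case: e => /=; lra. Qed.

Lemma bit_closed (e : bool) : 0 < (e%:R : R) < 1 -> False.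
Proof. by move=> /(@bit_open e). Qed.

Lemma sidept_side i t a s : 0 < t < 1 -> sidept i t = sidept a s -> i = a.
Proof.
move=> ht E; have h o := congr1 (co o) E.
have ht' : 0 < (if (i < 2)%N then t else 1 - t) < 1 by case: (i < 2)%N; lra.
have ei : odd i = odd a.
  apply: contrapT => n; have := h (odd i); rewrite !sideptE co_pt.
  have -> : odd i = ~~ odd a by case: (odd i) (odd a) n => [] [].
  by rewrite co_ptN; exact: bit_open.
have := h (~~ odd i); rewrite !sideptE -ei !co_ptN => /eqP; rewrite eqr_nat => cc.
by move: ei cc; elim/ord4_ind: i {E h ht'}; elim/ord4_ind: a.
Qed.

Lemma corner_sidept a i t : 0 < t < 1 -> corner R a <> sidept i t.
Proof.
move=> ht /(congr1 (co (odd i))); rewrite co_corner sideptE co_pt => /esym.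
by apply: bit_open; case: (i < 2)%N; lra.
Qed.

Lemma side_point q i X : side (cell0 q) i X ->
  exists2 t, 0 < t < 1 & X = chart q (sidept i t).
Proof. by rewrite side_cell0 => /arcP. Qed.

Lemma sides_meet q i q' i' X : side (cell0 q) i X -> side (cell0 q') i' X ->
  side (cell0 q) i = side (cell0 q') i'.
Proof.
move=> /side_point[t ht ->] /side_point[t' ht' E].
have sq := square_sidept i (open_closed01 ht); have sq' := square_sidept i' (open_closed01 ht').
have [qq|qq] := eqVneq q q'.
  by subst q'; rewrite (sidept_side ht (chart_inj sq sq' E)).
case: (glue qq sq sq' E) => [[a [b [e _]]]|[a [b [sg [s [_ e e']]]]]].
  by case: (@corner_sidept a i t ht).
by rewrite (sidept_side ht e) (sidept_side ht' e'); exact: side_glueE sg.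
Qed.

Lemma interior_chart q q' u u' : (forall o, 0 < co o u < 1) -> closed_square R u' ->
  chart q u = chart q' u' -> q = q' /\ u = u'.
Proof.
move=> hu hu' E; have sq : closed_square R u.
  by apply/squareP => o; exact: open_closed01.
have [qq|qq] := eqVneq q q'; first by subst q'; split=> //; exact: chart_inj E.
case: (glue qq sq hu' E) => [[a [b [e _]]]|[a [b [sg [s [_ e e']]]]]].
  by have := hu false; rewrite e co_corner => /bit_closed.
by have := hu (~~ odd a); rewrite e sideptE co_ptN => /bit_closed.
Qed.

Lemma opencell0 q X : opencell (cell0 q) X ->
  exists2 u, X = chart q u & forall o, 0 < co o u < 1.
Proof.
by rewrite cell0_rect => /opencellP[u -> hu]; exists u => // o; have := hu o; rewrite mul1r.
Qed.

Lemma initial_elements c : c \in elements (initial_tmesh M0 di) -> exists q, c = cell0 q.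
Proof. by case/imfsetP => q _ ->; exists q. Qed.

Lemma initial_edges F : F \in edges (initial_tmesh M0 di) ->
  exists q i, F = Edge (side (cell0 q) i) 0 (di (side (cell0 q) i)).
Proof. by case/imfset2P => q _ [i _ ->]; exists q, i. Qed.

Lemma initial_nodes X : X \in nodes (initial_tmesh M0 di) ->
  exists q i, X = chart q (corner R i).
Proof. by case/imfset2P => q _ [i _ ->]; exists q, i; rewrite /vertex ffunE. Qed.

Lemma valid_initial : valid di (initial_tmesh M0 di).
Proof.
split.
- move=> F /initial_edges[q [i ->]]; rewrite dirq_side //.
  exists q, (odd i), 0%N, (2 * cbit (~~ odd i) i)%N; split=> //=.
    by case: cbit.
  by rewrite cell0_rect side_rect /dyedge -grid_split.
- move=> c /initial_elements[q ->]; exists q, (fun=> 0%N), (fun=> 0%N).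
  by split=> //; exact: cell0_rect.
- move=> F G X /initial_edges[q [i ->]] /initial_edges[q' [i' ->]] /= h h'.
  by rewrite (sides_meet h h').
- move=> c c' X /initial_elements[q ->] /initial_elements[q' ->].
  move=> /opencell0[u -> hu] /opencell0[v E hv].
  have sv : closed_square R v by apply/squareP => o; exact: open_closed01.
  by have [->] := interior_chart hu sv E.
- move=> F c X /initial_edges[q [i ->]] /initial_elements[q' ->] /= /side_point[t ht ->].
  move=> /opencell0[u E hu].
  have [_ eu] := interior_chart hu (square_sidept i (open_closed01 ht)) (esym E).
  by have := hu (~~ odd i); rewrite eu sideptE co_ptN => /bit_closed.
- move=> F X /initial_edges[q [i ->]] /initial_nodes[q' [j ->]] /= /side_point[t ht E].
  have sq := square_sidept i (open_closed01 ht); have sc := square_corner R j.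
  have [qq|qq] := eqVneq q' q.
    by subst q'; exact: (@corner_sidept j i t ht (chart_inj sc sq E)).
  case: (glue qq sc sq E) => [[a [b [_ e]]]|[a [b [_ [s [_ e e']]]]]].
    by case: (@corner_sidept b i t ht).
  have ib := sidept_side ht e'; move: e'; rewrite ib => /sidept_inj ts.
  by apply: (@corner_sidept j a s _ e); lra.
- move=> c X /initial_elements[q ->] /initial_nodes[q' [j ->]] /opencell0[u E hu].
  have [_ eu] := interior_chart hu (square_corner R j) (esym E).
  by have := hu false; rewrite eu co_corner => /bit_closed.
- move=> c i /initial_elements[q ->]; exists (Edge (side (cell0 q) i) 0 (di (side (cell0 q) i)));
    last by left.
  by apply/imfset2P; exists q => //; exists i.
Qed.

End Initial.

(** * Chains of requests *)

Section Requests.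
Variables (R : realType) (d : nat) (M0 : quad_mesh R d).
Variable di : set 'rV[R]_d -> nat.
Variable p : nat.
Implicit Types (E F G : edge R d) (o : bool).

Notation dirq := (dirq di).
Notation dyadic := (dyadic M0 di).
Notation emid := (emid M0).
Notation close := (close M0).

Definition lexlt F E : bool :=
  (level F < level E)%N || (level F == level E) && (dir F < dir E)%N.

(** The recursive requests that the refinement of E can trigger. Each single one
    is determined by the two edges alone, whatever the mesh looks like when it
    is issued. *)
Inductive below : edge R d -> edge R d -> Prop :=
| BelowRefl E : below E E
| BelowStep E F G : dyadic F -> lexlt F E ->
    (edge_dist M0 E F <= (p.+1%:R / 2 * 2 ^- level E)%:E)%E -> below F G -> below E G.

Lemma lexlt_trans F G E : lexlt G F -> lexlt F E -> lexlt G E.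
Proof. by rewrite /lexlt; lia. Qed.

Lemma below_lex E G : below E G -> G = E \/ lexlt G E.
Proof.
elim=> [F|E' F G' _ FE _ _ [->|GF]]; [by left|by right|right].
exact: lexlt_trans GF FE.
Qed.

Definition dir_bound : nat := \sum_(q : elt M0) (dirq q false + dirq q true)%N.

Lemma dir_le F : dyadic F -> (dir F <= dir_bound)%N.
Proof.
move=> [q [ o [k [m [_ _ ->]]]]] /=; rewrite /dir_bound (bigD1 q) //=.
by apply: leq_trans (leq_addr _ _); case: o; rewrite ?leq_addr ?leq_addl.
Qed.

Definition reach_factor : nat := p.+1 * (2 * dir_bound + 1).

(** A potential for the distances covered by a cascade of requests. If the level
    drops, the unit 2^-(level F) at least doubles, while with B the bound on the
    direction indices, the parenthesis stays between B + 1 and 2 B + 1; if only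
    the direction index drops, the parenthesis gains 1. In both cases the gain
    covers twice the range of the request. *)
Definition weight F : R :=
  p.+1%:R * (2 * dir_bound%:R + 1 - (dir F)%:R) / 2 ^+ level F.

Lemma weight_bounds F : dyadic F -> 0 <= weight F <= reach_factor%:R / 2 ^+ level F.
Proof.
move=> /dir_le/(le_natR R) h; rewrite /weight /reach_factor.
have h0 := ler0n R (dir F); have h1 := ler0n R p.+1.
have h2 : 0 <= (2 ^+ level F)^-1 :> R by rewrite invr_ge0 exprn_ge0.
rewrite natrM natrD natrM; apply/andP; split.
  by rewrite mulr_ge0 // mulr_ge0 //; lra.
by rewrite ler_wpM2r // ler_wpM2l //; lra.
Qed.

Lemma weight_step E F : dyadic E -> dyadic F -> lexlt F E ->
  weight E + p.+1%:R / 2 ^+ level E <= weight F.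
Proof.
move=> /dir_le/(le_natR R) hE /dir_le/(le_natR R) hF; rewrite /weight.
have h0 := ler0n R (dir F); have h0' := ler0n R (dir E).
rewrite -mulrDl -{2}[p.+1%:R]mulr1 -mulrDr -!mulrA.
have hl : 0 < (2 ^+ level E)^-1 :> R by rewrite invr_gt0 pow2_gt0.
case/orP=> [hlev|/andP[/eqP -> hdir]]; rewrite ler_wpM2l //.
  have -> : (2 ^+ level F)^-1 = 2 ^+ (level E - level F) * (2 ^+ level E)^-1 :> R.
    rewrite -{2}(subnK (ltnW hlev)) exprD; field.
    by rewrite !pow2_neq0.
  rewrite mulrA ler_wpM2r ?(ltW hl) //.
  have : 2%:R <= 2 ^+ (level E - level F) :> R.
    rewrite -natr_pow2 ler_nat -{1}(expn1 2) leq_exp2l //; move: hlev; lia.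
  by move=> h2; nra.
rewrite ler_wpM2r ?(ltW hl) //.
by have := le_natR R hdir; rewrite -[(dir F).+1%:R]natr1; lra.
Qed.

Lemma below_weight E G : below E G -> dyadic E ->
  [/\ dyadic G, (level G <= level E)%N, weight E <= weight G &
    close (weight G - weight E) (emid E) (emid G)].
Proof.
elim=> [F dF|E' F G' dF FE hd _ IH dE].
  by split=> //; apply: close_refl; rewrite subrr.
have [dG lG wG cG] := IH dF; have wF := weight_step dE dF FE.
have p0 : 0 < p.+1%:R / 2 ^+ level E' :> R by rewrite divr_gt0 ?pow2_gt0 // ltr0n.
split=> //.
- by apply: leq_trans lG _; move: FE; rewrite /lexlt; lia.
- lra.
have h : close (p.+1%:R / 2 ^+ level E') (emid E') (emid F).
  have -> : p.+1%:R / 2 ^+ level E' = 2 * (p.+1%:R / 2 * 2 ^- level E') :> R.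
    by field; rewrite pow2_neq0.
  apply: mesh_dist_close hd; lra.
apply: close_le (close_trans h cG); lra.
Qed.

Lemma below_close E G : below E G -> dyadic E -> [/\ dyadic G, (level G <= level E)%N &
  close (reach_factor%:R / 2 ^+ level G) (emid E) (emid G)].
Proof.
move=> h dE; have [dG lG wG cG] := below_weight h dE; split=> //.
by apply: close_le cG; have := weight_bounds dE; have := weight_bounds dG; lra.
Qed.

End Requests.

(** * Refinement as a sequence of subdivisions *)

Section Traces.
Variables (R : realType) (d : nat) (M0 : quad_mesh R d).
Variable di : set 'rV[R]_d -> nat.
Hypothesis diP : direction_labeling M0 di.
Variable p : nat.
Hypothesis p_gt0 : (0 < p)%N.
Implicit Types (q : elt M0) (u v : R * R) (x y r : R) (X Y A B : 'rV[R]_d) (o e : bool).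
Implicit Types (a n : bool -> nat) (i : 'I_4) (c : cell M0).
Implicit Types (E F G V : edge R d) (M : tmesh M0).

Notation dirq := (dirq di).
Notation dyadic := (dyadic M0 di).
Notation emid := (emid M0).
Notation valid := (valid di).
Notation close := (close M0).
Notation below := (below M0 di p).

Definition step M E M' : Prop :=
  [/\ E \in edges M, obstructing p M E = fset0 & subdiv M E M'].

(** How a new edge F is related to the edge E whose subdivision creates it. *)
Definition creates E F : Prop := [/\ (level E <= level F)%N, (level F <= (level E).+1)%N &
  close (2 ^- level E) (emid E) (emid F)].

Lemma hop_chart j q u v (k : bool -> nat) : (forall o, k o < 2 ^ j)%N ->
  (forall o, (k o)%:R <= 2 ^+ j * co o u <= (k o).+1%:R) ->
  (forall o, (k o)%:R <= 2 ^+ j * co o v <= (k o).+1%:R) ->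
  hop M0 j (chart q u) (chart q v).
Proof.
move=> hk hu hv; exists (q, k false, k true).
  by split=> [[]|]; [exact: hk|exact: hk|exists u => // -[]; [exact: hu|exact: hu]].
by split=> [[]|]; [exact: hk|exact: hk|exists v => // -[]; [exact: hv|exact: hv]].
Qed.

Lemma half_box (j m : nat) : m%:R <= 2 ^+ j * ((2 * m + 1)%N%:R / 2 ^+ j.+1 : R) <= m.+1%:R.
Proof.
have -> : 2 ^+ j * ((2 * m + 1)%N%:R / 2 ^+ j.+1) = m%:R + 1 / 2 :> R.
  by rewrite exprS natrD natrM; field; rewrite pow2_neq0.
by rewrite -[m.+1%:R]natr1; lra.
Qed.

Lemma child_created E q o (k m : nat) e : (k < 2 ^ level E)%N -> (m <= 2 ^ (level E).+1)%N ->
  E = dyedge di q o (level E) k m ->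
  creates E (child_edge E q o k (m%:R / 2 ^+ (level E).+1) e).
Proof.
move=> hk hm EE; split=> //.
have cE : emid E = chart q (gridpt R (level E).+1 (emidx o k m)).
  by rewrite {1}EE emid_dyedge.
have hk2 : (2 * k + e < 2 ^ (level E).+1)%N by rewrite expnS; case: e; lia.
have cF : emid (child_edge E q o k (m%:R / 2 ^+ (level E).+1) e) =
    chart q (pt o ((2 * (2 * k + e) + 1)%N%:R / 2 ^+ (level E).+2) (m%:R / 2 ^+ (level E).+1)).
  by rewrite /emid seg_mid_chart //; exact: grid_bounds.
rewrite cE cF; apply: close_hop.
have sq := gridpt_square R (emidx_le o hk hm).
have [b [hb [u eu hu]] bq] := box_exists (level E) q sq.
have {}eu : u = gridpt R (level E).+1 (emidx o k m).
  by apply: (@chart_inj _ _ _ q); [exact: inbox_square hu| |rewrite -{1}bq -eu].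
apply: (@hop_chart _ _ _ _ (sel o k (idx b (~~ o)))).
- by apply: (sel_forall (P := fun _ z => z < 2 ^ level E)%N).
- move=> o'; have [->|->] := axis_cases o o'.
    rewrite sel1 co_gridpt /emidx eqxx; exact: half_box.
  by rewrite selN -eu; exact: hu.
- move=> o'; have [->|->] := axis_cases o o'.
    rewrite sel1 co_pt.
    have := half_box (level E).+1 (2 * k + e); rewrite exprS -mulrA.
    rewrite -[(2 * k + e).+1%:R]natr1 -[k.+1%:R]natr1 (natrD _ (2 * k)) natrM.
    by case: (e) => /=; lra.
  rewrite selN co_ptN; have := hu (~~ o); rewrite eu co_gridpt /emidx.
  by case: (o).
Qed.

Lemma cut_created M M' E F : valid M -> step M E M' -> F \in cut_edges M E -> creates E F.
Proof.
move=> MV [EM Eobs EM'] /(cut_edgesP diP p_gt0 MV EM Eobs).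
move=> [q [a [n [i [hs hn [lE dE h sh ->]]]]]].
have [_ si _] := (splitsP _ _ _ _).1 hs.
have [_ _ cE] := side_edge diP (edges_dyadic MV EM) hn (esym si).
split=> /=; [by rewrite lE; case/andP: h|by rewrite lE; case/andP: h|].
set o := odd i in h lE cE *.
rewrite cE /emid /= cut_rect seg_mid_chart; first last.
- by apply: grid_bounds; have := hn o; rewrite expnS -/o; lia.
- exact: hn.
apply: close_hop; rewrite lE.
have swap x y : pt (~~ o) x y = pt o y x by case: (o).
rewrite swap.
pose N := (n (~~ o))./2.
have hN := hn (~~ o); have ho := hn o.
have [e|e] : a (~~ o) = a o \/ a (~~ o) = (a o).+1 by lia.
  apply: (@hop_chart _ _ _ _ (sel o (n o) (n (~~ o)))).
  - by apply: (sel_forall (P := fun _ z => z < 2 ^ a o)%N) => //; rewrite -e.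
  - move=> o'; have [->|->] := axis_cases o o'.
      by rewrite sel1 co_pt; exact: half_box.
    rewrite selN co_ptN e mulrC divfK ?pow2_neq0 // !ler_nat.
    by case: (cbit _ _); lia.
  - move=> o'; have [->|->] := axis_cases o o'.
      by rewrite sel1 co_pt; exact: half_box.
    by rewrite selN co_ptN e; exact: half_box.
have dv (z : R) : 2 ^+ a o * (z / 2 ^+ (a o).+1) = z / 2.
  by rewrite exprS; field; rewrite pow2_neq0.
have nN : n (~~ o) = (odd (n (~~ o)) + 2 * N)%N by rewrite /N; lia.
apply: (@hop_chart _ _ _ _ (sel o (n o) N)).
- apply: (sel_forall (P := fun _ z => z < 2 ^ a o)%N) => //.
  by move: hN; rewrite e expnS /N; lia.
- move=> o'; have [->|->] := axis_cases o o'.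
    by rewrite sel1 co_pt; exact: half_box.
  rewrite selN co_ptN e dv ler_pdivlMr // ler_pdivrMr // -!natrM !ler_nat.
  by case: (cbit _ _); lia.
- move=> o'; have [->|->] := axis_cases o o'.
    by rewrite sel1 co_pt; exact: half_box.
  have h1 := half_box (a o).+1 (n (~~ o)).
  rewrite selN co_ptN e; move: h1; rewrite exprS -mulrA.
  set z := 2 ^+ a o * _ => h1.
  have : 2 * N%:R <= 2 * z <= 2 * N.+1%:R.
    rewrite -!natrM; case/andP: h1 => h1 h2; apply/andP; split.
      by apply: le_trans h1; rewrite ler_nat; lia.
    by apply: le_trans h2 _; rewrite ler_nat; lia.
  lra.
Qed.

Lemma step_created M M' E F : valid M -> step M E M' -> F \in edges M' ->
  F \in edges M \/ creates E F.
Proof.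
move=> MV hst; case: (hst) => EM Eobs EM'.
have [q [ o [k [m [hk hm EE h]]]]] := subdiv_edges MV EM EM'.
move/h => [[_ ?]|[e ->]|hF]; [by left|right|right]; first exact: child_created.
exact: cut_created MV hst hF.
Qed.

(** The new edges are dyadic edges of two levels in the vicinity of the
    subdivided edge. *)
Lemma step_card : exists K : nat, forall M M' E, valid M -> step M E M' ->
  (#|` edges M'| <= #|` edges M| + K)%N.
Proof.
have [K hK] := packing M0 di 2; exists (K + K)%N => M M' E MV hst.
case: (hst) => EM Eobs EM'.
have MV' := valid_step diP p_gt0 MV EM Eobs EM'.
have hE := emid_onmesh (edges_dyadic MV EM).
have [s0 z0 h0] := hK (level E) _ hE.
have [s1 z1 h1] := hK (level E).+1 _ hE.
apply: (@leq_trans (size (edges M ++ (s0 ++ s1)))); last first.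
  by rewrite !size_cat leq_add2l leq_add.
apply: uniq_leq_size; first exact: fset_uniq.
move=> F hF; rewrite !mem_cat.
have [->//|[l1 l2 cl]] := step_created MV hst hF.
have dF := edges_dyadic MV' hF.
have p0 : 0 < 2 ^- level E :> R by rewrite invr_gt0 pow2_gt0.
have [e|e] : level F = level E \/ level F = (level E).+1 by lia.
  by rewrite h0 ?orbT //; apply: close_le cl; lra.
rewrite (h1 F) ?orbT //; apply: close_le cl; rewrite half_pow2; lra.
Qed.

Inductive steps : tmesh M0 -> seq (edge R d) -> tmesh M0 -> Prop :=
| StepsNil M : steps M [::] M
| StepsCons M E M1 t M2 : step M E M1 -> steps M1 t M2 -> steps M (E :: t) M2.

Lemma steps_cat M t M1 t' M2 : steps M t M1 -> steps M1 t' M2 -> steps M (t ++ t') M2.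
Proof. by elim=> // M3 E M4 t1 M5 h _ IH /IH; exact: StepsCons. Qed.

Lemma steps_valid M t M' : steps M t M' -> valid M -> valid M'.
Proof.
by elim=> // M3 E M4 t1 M5 [h1 h2 h3] _ IH MV; apply: IH; exact (valid_step diP p_gt0 MV h1 h2 h3).
Qed.

Lemma steps_nodes M t M' X : steps M t M' -> X \in nodes M -> X \in nodes M'.
Proof.
elim=> // M3 E M4 t1 M5 [_ _ h3] _ IH hX; apply: IH.
by apply/(subdiv_nodes h3); right.
Qed.

Lemma steps_edges M t M' F : steps M t M' -> valid M -> F \in edges M -> F \notin t ->
  F \in edges M'.
Proof.
elim=> // M3 E M4 t1 M5 [h1 h2 h3] _ IH MV hF; rewrite inE negb_or => /andP[FE Ft].
apply: IH => //; first exact (valid_step diP p_gt0 MV h1 h2 h3).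
exact: (step_edge MV h1 h3 hF FE).
Qed.

(** The midpoint of a subdivided edge becomes a node, and no edge runs through
    a node; hence no edge is subdivided twice. *)
Lemma steps_new M t M' : steps M t M' -> valid M ->
  uniq t /\ forall G, G \in t -> [/\ dyadic G, emid G \notin nodes M & emid G \in nodes M'].
Proof.
elim=> [//|M3 E M4 t1 M5 [h1 h2 h3] h IH MV].
have [ut1 ht1] := IH (valid_step diP p_gt0 MV h1 h2 h3).
have EX : emid E \in nodes M4 by apply/(subdiv_nodes h3); left.
have dE := edges_dyadic MV h1.
split.
  by rewrite /= ut1 andbT; apply/negP => /ht1[_ + _]; rewrite EX.
move=> G; rewrite inE => /orP[/eqP->|/ht1[dG G1 G2]]; split=> //.
- by apply/negP => hX; exact (nodes_edges MV h1 hX (emid_pts dE)).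
- exact: steps_nodes h EX.
- by apply: contra G1 => hX; apply/(subdiv_nodes h3); right.
Qed.

Lemma steps_created M t M' F : steps M t M' -> valid M -> F \in edges M' ->
  F \in edges M \/ exists2 G, G \in t & creates G F.
Proof.
elim=> [|M3 E M4 t1 M5 hst h IH MV hF]; first by left.
case: (hst) => h1 h2 h3.
have [hF4|[G hG hc]] := IH (valid_step diP p_gt0 MV h1 h2 h3) hF.
  have [|hc] := step_created MV hst hF4; first by left.
  by right; exists E => //; rewrite mem_head.
by right; exists G => //; rewrite inE hG orbT.
Qed.

Lemma steps_card K M t M' :
  (forall M M' E, valid M -> step M E M' -> (#|` edges M'| <= #|` edges M| + K)%N) ->
  steps M t M' -> valid M -> (#|` edges M'| <= #|` edges M| + K * size t)%N.
Proof.
move=> hK; elim=> [M1 _|M3 E M4 t1 M5 hst h IH MV]; first by rewrite muln0 addn0.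
case: (hst) => h1 h2 h3.
apply: leq_trans (IH (valid_step diP p_gt0 MV h1 h2 h3)) _.
by rewrite /= mulnS addnA leq_add2r; exact: (hK _ _ _ MV hst).
Qed.

Scheme refine_ind3 := Minimality for refine Sort Prop
with refine_loop_ind3 := Minimality for refine_loop Sort Prop
with refine_pass_ind3 := Minimality for refine_pass Sort Prop.

(** The edge E survives its own loop, because all requests are
    lexicographically smaller than E. *)
Lemma refine_steps M E M' : refine p M E M' -> valid M -> E \in edges M ->
  exists2 t, steps M t M' & E \in t /\ forall G, G \in t -> below E G.
Proof.
pose P M E M' := valid M -> E \in edges M ->
  exists2 t, steps M t M' & E \in t /\ forall G, G \in t -> below E G.
pose P0 M E M1 := valid M -> E \in edges M ->
  exists2 t, steps M t M1 & [/\ forall G, G \in t -> below E G /\ lexlt G E,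
     E \in edges M1 & obstructing p M1 E = fset0].
pose P1 M (s : seq (edge R d)) M1 := valid M ->
  exists2 t, steps M t M1 &
    forall G, G \in t -> exists F, [/\ F \in s, dyadic F & below F G].
apply: (refine_ind3 (P := P) (P0 := P0) (P1 := P1)); rewrite /P /P0 /P1.
- move=> {}M {}E M1 M2 _ IH h MV EM; have [t ht [tE EM1 hob]] := IH MV EM.
  exists (t ++ [:: E]).
    apply: steps_cat ht (StepsCons _ (StepsNil _)); exact: And3 h.
  split; first by rewrite mem_cat mem_head orbT.
  move=> G; rewrite mem_cat inE => /orP[/tE[]//|/eqP ->]; exact: BelowRefl.
- by move=> {}M {}E hob MV EM; exists [::]; [exact: StepsNil|].
- move=> {}M {}E s M1 M2 _ hs _ IH1 _ IH2 MV EM.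
  have [t ht tG] := IH1 MV.
  have tE G : G \in t -> below E G /\ lexlt G E.
    move=> /tG[F [Fs dF FG]].
    have : F \in obstructing p M E by rewrite -(perm_mem hs).
    rewrite /obstructing /neighb !inE /= => /andP[/andP[_ /asboolP hd] hl].
    split; first exact: BelowStep hd FG.
    by case: (below_lex FG) => [->//|GF]; exact: lexlt_trans GF hl.
  have Et : E \notin t.
    by apply/negP => /tE[_]; rewrite /lexlt ltnn eqxx ltnn.
  have MV1 := steps_valid ht MV.
  have [t' ht' [tE' EM2 hob]] := IH2 MV1 (steps_edges ht MV EM Et).
  exists (t ++ t'); first exact: steps_cat ht ht'.
  by split=> // G; rewrite mem_cat => /orP[/tE|/tE'].
- by move=> {}M MV; exists [::]; [exact: StepsNil|].
- move=> {}M F s M1 _ _ IH MV; have [t ht tG] := IH MV; exists t => // G /tG[F' [h1 h2 h3]].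
  by exists F'; split=> //; rewrite inE h1 orbT.
- move=> {}M F s M1 M2 FM _ IH1 _ IH2 MV; have [t ht [_ tF]] := IH1 MV FM.
  have [t' ht' tG] := IH2 (steps_valid ht MV); exists (t ++ t'); first exact: steps_cat ht ht'.
  move=> G; rewrite mem_cat => /orP[/tF h|/tG[F' [h1 h2 h3]]].
    by exists F; split=> //; [exact: mem_head|exact (edges_dyadic MV FM)].
  by exists F'; split=> //; rewrite inE h1 orbT.
Qed.

End Traces.

(** * Charging subdivisions to marked edges *)

Section Charging.
Variables (R : realType) (T : choiceType) (lev : T -> nat).
Variable close : R -> T -> T -> Prop.
Hypothesis close_le : forall r s x y, r <= s -> close r x y -> close s x y.
Hypothesis close_trans : forall r s x y z, close r x y -> close s y z ->
  close (r + s) x z.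
Variables (J : nat) (E : nat -> T) (t : nat -> seq T) (D A K : nat).

Let all_t := flatten [seq t j | j <- iota 0 J].

Hypothesis tP : forall j F, (j < J)%N -> F \in t j ->
  (lev F <= lev (E j))%N /\ close (D%:R / 2 ^+ lev F) (E j) F.
Hypothesis E_created : forall j, (j < J)%N -> (0 < lev (E j))%N ->
  exists2 i, (i < j)%N &
    (lev (E j) <= (lev (E i)).+1)%N /\ close (A%:R / 2 ^+ lev (E j)) (E i) (E j).
Hypothesis pack : forall j l, (j < J)%N -> exists2 s : seq T, (size s <= K)%N &
  forall F, F \in all_t -> lev F = l -> close ((D + A)%:R / 2 ^+ l) (E j) F -> F \in s.
Hypothesis all_uniq : uniq all_t.

Definition charged F i : bool :=
  (lev F <= lev (E i))%N && `[< close ((D + A)%:R / 2 ^+ lev F) (E i) F >].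

Definition charge F i : R := if charged F i then 2 ^- (lev (E i) - lev F) else 0.

Lemma charge_ge0 F i : 0 <= charge F i.
Proof. by rewrite /charge; case: ifP => // _; rewrite invr_ge0 exprn_ge0. Qed.

Lemma charge_mono F m n : (m <= n)%N ->
  \sum_(0 <= i < m) charge F i <= \sum_(0 <= i < n) charge F i.
Proof.
move=> mn; rewrite [leRHS](big_cat_nat _ mn) //= lerDl.
by apply: sumr_ge0 => i _; exact: charge_ge0.
Qed.

(** Walk from a marked edge to the one whose refinement created it, and so on.
    The distance covered is at most A times the charge collected so far, in
    units of the size of F; as long as this charge is below 1, the walk stays in
    the range where charges are collected. It cannot leave the level of F
    before having collected 1, since an edge of that level contributes 1. *)
Lemma charge_ge F i acc : (i < J)%N -> 0 <= acc < 1 -> (lev F <= lev (E i))%N ->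
  close ((D%:R + A%:R * acc) / 2 ^+ lev F) (E i) F ->
  1 - acc <= \sum_(0 <= k < i.+1) charge F k.
Proof.
elim/ltn_ind: i acc => i IH acc iJ /andP[a0 a1] li ci.
pose w : R := 2 ^- (lev (E i) - lev F).
have p0 : 0 < (2 ^+ lev F)^-1 :> R by rewrite invr_gt0 exprn_gt0.
have A0 : 0 <= A%:R :> R by [].
have w0 : 0 < w by rewrite invr_gt0 exprn_gt0.
have cw : charge F i = w.
  rewrite /charge /charged li /=; case: asboolP => // h; case: h.
  by apply: close_le ci; rewrite ler_wpM2r ?(ltW p0) // natrD; nra.
rewrite big_nat_recr //= cw.
have S0 : 0 <= \sum_(0 <= k < i) charge F k.
  by apply: sumr_ge0 => k _; exact: charge_ge0.
case: (leP 1 (acc + w)) => haw; first by lra.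
have lt : (lev F < lev (E i))%N.
  rewrite ltn_neqAle li andbT; apply/eqP => e.
  by move: haw; rewrite /w e subnn expr0 invr1; lra.
have [k ki [lk ck]] := E_created iJ (leq_ltn_trans (leq0n _) lt).
have := IH k ki (acc + w) (ltn_trans ki iJ) _ _ _.
have -> : 0 <= acc + w < 1 by apply/andP; split=> //; lra.
move=> /(_ isT); have -> : (lev F <= lev (E k))%N by lia.
move=> /(_ isT) h; have {}h : 1 - (acc + w) <= \sum_(0 <= k0 < k.+1) charge F k0.
  apply: h; apply: close_le (close_trans ck ci).
  have -> : (2 ^+ lev (E i))^-1 = w / 2 ^+ lev F :> R.
    by rewrite /w -{1}(subnK li) exprD invfM.
  by rewrite mulrA -mulrDl ler_wpM2r ?(ltW p0) //; lra.
have := charge_mono F ki; lra.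
Qed.

Lemma geometric_le L : \sum_(l < L.+1) 2 ^- (L - l) <= 2 :> R.
Proof.
elim: L => [|L IH]; first by rewrite big_ord1 subnn expr0 invr1; lra.
rewrite big_ord_recr /= subnn expr0 invr1.
have -> : \sum_(l < L.+1) 2 ^- (L.+1 - l) = (\sum_(l < L.+1) 2 ^- (L - l)) / 2 :> R.
  rewrite big_distrl /=; apply: eq_bigr => l _.
  by rewrite subSn ?exprS ?invfM 1?mulrC // -ltnS.
by lra.
Qed.

(** For each level there are at most K charged edges, and the charges decay
    geometrically with the level. *)
Lemma charge_le i : (i < J)%N -> \sum_(F <- all_t) charge F i <= (2 * K)%:R.
Proof.
move=> iJ; rewrite /charge -big_mkcond /=; set L := lev (E i).
rewrite (partition_big (fun F => inord (lev F) : 'I_L.+1) xpredT) //=.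
apply: (@le_trans _ _ (\sum_(l < L.+1) K%:R * 2 ^- (L - l))); last first.
  rewrite -big_distrr natrM [2%:R * _]mulrC /= ler_wpM2l //; exact: geometric_le.
apply: ler_sum => l _.
have [s sK hs] := pack l iJ.
rewrite (eq_bigr (fun=> 2 ^- (L - l))); last first.
  move=> F /andP[/andP[h _] /eqP <-]; rewrite inordK //.
rewrite big_const_seq iter_addr_0 -[leLHS]mulr_natl ler_wpM2r ?invr_ge0 ?exprn_ge0 // ler_nat.
rewrite -size_filter; apply: leq_trans sK; apply: uniq_leq_size.
  exact: filter_uniq.
move=> F; rewrite mem_filter => /andP[/andP[/andP[h /asboolP cF] /eqP el] hF].
have e : lev F = l by rewrite -el inordK.
by apply: hs => //; rewrite -e.
Qed.

Lemma charging : (size all_t <= 2 * K * J)%N.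
Proof.
rewrite -(ler_nat R).
have -> : (size all_t)%:R = \sum_(F <- all_t) 1 :> R.
  by rewrite big_const_seq iter_addr_0 count_predT.
apply: (@le_trans _ _ (\sum_(F <- all_t) \sum_(0 <= i < J) charge F i)).
  rewrite !big_seq; apply: ler_sum => F /flattenP[_ /mapP[j + ->] Fj].
  rewrite mem_iota add0n => /= jJ.
  have [lF cF] := tP jJ Fj.
  apply: le_trans (charge_mono F jJ); rewrite -[leLHS]subr0.
  by apply: charge_ge => //; rewrite ?lexx ?ltr01 // mulr0 addr0.
rewrite exchange_big /= big_mkord.
apply: (@le_trans _ _ (\sum_(i < J) (2 * K)%:R)); first by apply: ler_sum => i _; exact: charge_le.
by rewrite sumr_const card_ord -[leLHS]mulr_natr -natrM.
Qed.

End Charging.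

(** * Runs of the algorithm *)

Section Runs.
Variables (R : realType) (d : nat) (M0 : quad_mesh R d).
Variable di : set 'rV[R]_d -> nat.
Hypothesis diP : direction_labeling M0 di.
Variable p : nat.
Hypothesis p_gt0 : (0 < p)%N.
Variables (J : nat) (M : nat -> tmesh M0) (E : nat -> edge R d) (t : nat -> seq (edge R d)).
Hypothesis M_0 : M 0%N = initial_tmesh M0 di.
Hypothesis EM : forall j, (j < J)%N -> E j \in edges (M j).
Hypothesis tP : forall j, (j < J)%N -> [/\ steps p (M j) (t j) (M j.+1), E j \in t j &
  forall G, G \in t j -> below M0 di p (E j) G].

Definition run n := flatten [seq t j | j <- iota 0 n].

Lemma run_steps n : (n <= J)%N -> steps p (M 0%N) (run n) (M n).
Proof.
elim: n => [_|n IH nJ]; first exact: StepsNil.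
rewrite /run -addn1 iotaD map_cat flatten_cat /= cats0 add0n addn1.
have [h _ _] := tP nJ; apply: steps_cat h; exact: IH (ltnW nJ).
Qed.

Lemma valid0 : valid di (M 0%N).
Proof. by rewrite M_0; exact: valid_initial. Qed.

Lemma run_valid n : (n <= J)%N -> valid di (M n).
Proof. by move=> /run_steps/(steps_valid diP p_gt0); apply; exact: valid0. Qed.

Lemma run_mem n G : G \in run n -> exists2 j, (j < n)%N & G \in t j.
Proof. by case/flattenP => _ /mapP[j + ->]; rewrite mem_iota add0n; exists j. Qed.

Lemma mem_run n j G : (j < n)%N -> G \in t j -> G \in run n.
Proof.
move=> jn hG; apply/flattenP; exists (t j) => //; apply: map_f.
by rewrite mem_iota.
Qed.

(** A marked edge is subdivided when it is refined, and it does not come back. *)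
Lemma marked_inj i j : (i < j)%N -> (j < J)%N -> E i <> E j.
Proof.
move=> ij jJ e; have [_ Et _] := tP (ltn_trans ij jJ).
have [_ h] := steps_new diP p_gt0 (run_steps (ltnW jJ)) valid0.
have [dE _ hn] := h _ (mem_run ij Et); rewrite e in dE hn.
exact: (nodes_edges (run_valid (ltnW jJ)) (EM jJ) hn (emid_pts dE)).
Qed.

Lemma marked_card : (J <= #|` [fset E j | j in iota 0 J]|)%N.
Proof.
rewrite -{1}(size_iota 0 J) -(size_map E); apply: uniq_leq_size.
  rewrite map_inj_in_uniq ?iota_uniq // => i j; rewrite !mem_iota !add0n /= => iJ jJ e.
  by case: (ltngtP i j) => // h; [case: (marked_inj h jJ)|case: (marked_inj h iJ)].
by move=> F /mapP[j hj ->]; apply/imfsetP; exists j.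
Qed.

Lemma run_dyadic j G : (j < J)%N -> G \in t j ->
  [/\ dyadic M0 di (E j), dyadic M0 di G, (level G <= level (E j))%N &
  close M0 ((reach_factor M0 di p)%:R / 2 ^+ level G) (emid M0 (E j)) (emid M0 G)].
Proof.
move=> jJ hG; have dE := edges_dyadic (run_valid (ltnW jJ)) (EM jJ).
have [_ _ /(_ _ hG)/below_close] := tP jJ.
by case/(_ dE).
Qed.

(** The marked edge whose refinement created E j. The creating subdivision is that
    of an edge G, at most one level below E j, near E i as well as E j. *)
Lemma marked_created j : (j < J)%N -> (0 < level (E j))%N ->
  exists2 i, (i < j)%N & (level (E j) <= (level (E i)).+1)%N /\
    close M0 ((2 * (reach_factor M0 di p).+1)%:R / 2 ^+ level (E j))
      (emid M0 (E i)) (emid M0 (E j)).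
Proof.
move=> jJ lE.
have [|[G hG [l1 l2 cl]]] := steps_created diP p_gt0 (run_steps (ltnW jJ)) valid0 (EM jJ).
  by rewrite M_0 => /initial_edges[q [i e]]; rewrite e in lE.
have [i ij Gi] := run_mem hG; exists i => //.
have [_ _ lG cG] := run_dyadic (ltn_trans ij jJ) Gi.
split; first exact: leq_trans l2 _.
apply: close_le (close_trans cG cl).
rewrite natrM -[X in _ <= 2 * X%:R / _]addn1 natrD.
have p0 : 0 < (2 ^+ level G)^-1 :> R by rewrite invr_gt0 exprn_gt0.
have h0 := ler0n R (reach_factor M0 di p).
have : (2 ^+ level G)^-1 <= 2 * (2 ^+ level (E j))^-1 :> R.
  have [->|->] : level (E j) = level G \/ level (E j) = (level G).+1 by lia.
    lra.
  by rewrite half_pow2; lra.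
nra.
Qed.

Lemma run_size K :
  (forall l X, onmesh M0 X -> exists2 s : seq (edge R d), (size s <= K)%N &
    forall F, dyadic M0 di F -> level F = l ->
    close M0 ((reach_factor M0 di p + 2 * (reach_factor M0 di p).+1)%:R / 2 ^+ l) X
      (emid M0 F) -> F \in s) ->
  (size (run J) <= 2 * K * J)%N.
Proof.
move=> hK.
pose cl r (F G : edge R d) := close M0 r (emid M0 F) (emid M0 G).
apply: (@charging R (edge R d) (@level R d) cl _ _ J E t (reach_factor M0 di p)
  (2 * (reach_factor M0 di p).+1) K).
- by move=> r s F G; exact: close_le.
- by move=> r s F G H; exact: close_trans.
- by move=> j F jJ hF; have [] := run_dyadic jJ hF.
- exact: marked_created.
- move=> j l jJ; have dE := edges_dyadic (run_valid (ltnW jJ)) (EM jJ).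
  have [s sK hs] := hK l _ (emid_onmesh dE); exists s => // F /run_mem[i iJ hF] lF cF.
  by apply: hs => //; have [] := run_dyadic iJ hF.
- by have [] := steps_new diP p_gt0 (run_steps (leqnn J)) valid0.
Qed.

End Runs.

Theorem theorem5p3 (R : realType) (d : nat) (M0 : quad_mesh R d)
    (di : set 'rV[R]_d -> nat) (p : nat) :
  direction_labeling M0 di -> odd p ->
  exists C : R, 0 < C /\
    forall (J : nat) (M : nat -> tmesh M0) (E : nat -> edge R d),
      M 0%N = initial_tmesh M0 di ->
      (forall j, (j < J)%N ->
         E j \in edges (M j) /\ refine p (M j) (E j) (M j.+1)) ->
      (#|` edges (M J)|)%:R - (#|` edges (M 0%N)|)%:R
        <= C * (#|` [fset E j | j in iota 0 J]|)%:R.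
Proof.
move=> diP /odd_gt0 p_gt0.
have [K1 hK1] := step_card diP p_gt0.
have [K2 hK2] := packing M0 di (reach_factor M0 di p + 2 * (reach_factor M0 di p).+1).
exists (K1 * (2 * K2)).+1%:R; split; first by rewrite ltr0n.
move=> J M E M_0 hM.
have [t tP] : exists t, forall j, (j < J)%N ->
    [/\ steps p (M j) (t j) (M j.+1), E j \in t j &
        forall G, G \in t j -> below M0 di p (E j) G].
  have vM j : (j <= J)%N -> valid di (M j).
    elim: j => [_|j IH jJ]; first by rewrite M_0; exact: valid_initial.
    have [h1 h2] := hM j jJ; have V := IH (ltnW jJ).
    have [s hs _] := refine_steps diP p_gt0 h2 V h1.
    exact: (steps_valid diP p_gt0 hs V).
  have /choice[t ht] j : exists s, (j < J)%N -> [/\ steps p (M j) s (M j.+1), E j \in s &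
        forall G, G \in s -> below M0 di p (E j) G].
    case: (ltnP j J) => jJ; last by exists [::].
    have [h1 h2] := hM j jJ.
    by have [s hs [h3 h4]] := refine_steps diP p_gt0 h2 (vM j (ltnW jJ)) h1; exists s.
  by exists t.
have EM j : (j < J)%N -> E j \in edges (M j) by move=> /hM[].
have V0 := valid0 diP M_0.
have h1 := steps_card diP p_gt0 hK1 (run_steps tP (leqnn J)) V0.
have h2 := run_size diP p_gt0 M_0 EM tP hK2.
have h3 := marked_card diP p_gt0 M_0 EM tP.
rewrite lerBlDl -natrM -natrD ler_nat.
apply: leq_trans h1 _; rewrite leq_add2l.
apply: leq_trans (leq_mul (leqnn K1) h2) _.
rewrite mulnA; apply: leq_mul h3; exact: leqnSn.
Qed.
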